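(* Let $(X,T,\mathcal{L},T,\mathcal{R})$ be an IKTQ and let $F$ be a compact oriented surface. Let $D$ and $D'$ be oriented flat link diagrams on $F$ such that $D'$ is obtained from $D$ by one flat Reidemeister move performed inside a disk $U\subset F$, and let $\mathcal{C}$, $\mathcal{C}'$ be IKTQ colorings by $X$ of $D$, $D'$, respectively, which agree on $F\setminus U$. Let $c_D$, $c_{D'}\in C_1(X)$ be the cycles assigned to the colored diagrams $(D,\mathcal{C})$ and $(D',\mathcal{C}')$. Then: (i) for a first, second or third flat Reidemeister move (with any orientations of the strands), $c_D$ and $c_{D'}$ represent the same class in $H_1^{NID}(X)$; (ii) for a second or third flat Reidemeister move (with any orientations of the strands), $c_D$ and $c_{D'}$ represent the same class in $H_1^{NI}(X)$. That is, the homology class of the cycle assigned to an IKTQ-colored oriented flat link diagram is invariant under all flat Reidemeister moves in $H^{NID}(X)$, and under the second and third flat Reidemeister moves in $H^{NI}(X)$.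
   Context: A ternary quasigroup $(X,T,\mathcal{L},\mathcal{M},\mathcal{R})$ is a set $X$ with ternary operations $T,\mathcal{L},\mathcal{M},\mathcal{R}\colon X^3\to X$ such that for all $x_1,x_2,x_3\in X$: $\mathcal{L}(T(x_1,x_2,x_3),x_2,x_3)=x_1=T(\mathcal{L}(x_1,x_2,x_3),x_2,x_3)$; $\mathcal{M}(x_1,T(x_1,x_2,x_3),x_3)=x_2=T(x_1,\mathcal{M}(x_1,x_2,x_3),x_3)$; $\mathcal{R}(x_1,x_2,T(x_1,x_2,x_3))=x_3=T(x_1,x_2,\mathcal{R}(x_1,x_2,x_3))$. An IKTQ (involutory knot-theoretic ternary quasigroup) is a ternary quasigroup with $\mathcal{M}=T$ satisfying, for all $a,b,c,d\in X$: (A3L) $T(T(a,b,c),c,d)=T\big(T(a,b,T(b,c,d)),\,T(b,c,d),\,d\big)$; (A3R) $T(a,b,T(b,c,d))=T\big(a,\,T(a,b,c),\,T(T(a,b,c),c,d)\big)$. Diagrams and colorings. A flat link diagram on $F$ is a generic immersed collection of closed curves on $F$ whose crossings (transverse double points) carry no over/under information; flat Reidemeister moves are the usual Reidemeister moves with over/under information forgotten. The regions of $D$ are the connected components of the complement in $F$ of the underlying curves. An IKTQ coloring of an oriented flat diagram $D$ by $X$ assigns an element of $X$ to each region so that the following holds at each crossing. Draw the crossing with both strands directed upward; let $a,b,c,d$ be the colors of the left, bottom (adjacent to the two incoming edges), right, and top (adjacent to the two outgoing edges) corners, respectively. Then $d=T(a,b,c)$. Colorings of $D$ and $D'$ agree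 on $F\setminus U$ if every point of $F\setminus U$ not on the diagram lies in regions of the same color for both. The chain assigned to a colored diagram is $c_D=\sum (a,b,c)\in C_1(X)$, the sum taken over all flat crossings; it satisfies $\partial_1(c_D)=0$. Homology. For $n\ge -1$, $C_n(X)=\mathbb{Z}\langle X^{n+2}\rangle$ is the free abelian group on $(n+2)$-tuples $x=(x_0,\ldots,x_{n+1})$, and $C_{-2}(X)=\mathbb{Z}$. Set $\partial_{-1}(x_0)=0$, $\partial_0(x_0,x_1)=x_1-x_0$, and for $n>0$ $\partial_n x=\sum_{i=0}^n(-1)^i (d_i^{n,L}x-d_i^{n,R}x)$, where $d_i^{n,L}x=(d_{i,1}^{n,L}x,\ldots,d_{i,n+1}^{n,L}x)$ with $d_{i,k}^{n,L}x=x_k$ if $k>i$ and $d_{i,k}^{n,L}x=T(x_{k-1},x_k,d_{i,k+1}^{n,L}x)$ if $k\le i$; and $d_i^{n,R}x=(d_{i,0}^{n,R}x,\ldots,d_{i,n}^{n,R}x)$ with $d_{i,k}^{n,R}x=x_k$ if $k\le i$ and $d_{i,k}^{n,R}x=T(d_{i,k-1}^{n,R}x,x_k,x_{k+1})$ if $k>i$. This is a chain complex. For $x\in X^{n+2}$ and $j\in\{1,\ldots,n\}$, let $x[j]$ be $x$ with $x_j$ replaced by $T(x_{j-1},x_j,x_{j+1})$. For $n\ge 1$, $C_n^I(X)$ is the subgroup of $C_n(X)$ generated by all sums $x+x[j]$, and $C_n^{ID}(X)$ is the subgroup generated by $C_n^I(X)$ together with all $(n+2)$-tuples containing, on three consecutive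 coordinates, either $a,b,\mathcal{R}(a,b,b)$ or $\mathcal{L}(b,b,a),b,a$ for some $a,b\in X$; for $n<1$, $C_n^I(X)=C_n^{ID}(X)=0$. These are subcomplexes of $(C_n(X),\partial_n)$. $H^{NI}(X)$ and $H^{NID}(X)$ are the homologies of the quotient complexes $C_n(X)/C_n^I(X)$ and $C_n(X)/C_n^{ID}(X)$ with the induced differentials. *)

(* Defs.v *)
From HB Require Import structures.
From mathcomp Require Import all_boot all_order all_algebra.
From mathcomp Require Import freeg.
From mathcomp Require Import all_classical all_reals all_analysis.

Set Implicit Arguments.
Unset Strict Implicit.
Unset Printing Implicit Defensive.

Import Order.TTheory GRing.Theory Num.Theory.
Import numFieldNormedType.Exports.

Local Open Scope classical_set_scope.
Local Open Scope ring_scope.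

(** * Involutory knot-theoretic ternary quasigroups *)

Definition ternary_quasigroup (X : Type) (T L M Q : X -> X -> X -> X) : Prop :=
  [/\ forall x1 x2 x3, L (T x1 x2 x3) x2 x3 = x1 /\ T (L x1 x2 x3) x2 x3 = x1,
      forall x1 x2 x3, M x1 (T x1 x2 x3) x3 = x2 /\ T x1 (M x1 x2 x3) x3 = x2 &
      forall x1 x2 x3, Q x1 x2 (T x1 x2 x3) = x3 /\ T x1 x2 (Q x1 x2 x3) = x3].

Definition iktq (X : Type) (T L Q : X -> X -> X -> X) : Prop :=
  [/\ ternary_quasigroup T L T Q,
      forall a b c d,
        T (T a b c) c d = T (T a b (T b c d)) (T b c d) d &
      forall a b c d,
        T a b (T b c d) = T a (T a b c) (T (T a b c) c d)].

(** * Homology *)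

(* [chain X n] is C_n(X), for n >= 0 only: degrees -1 and -2 play no role in
   first homology. *)
Notation chain X n := {freeg ((n.+2).-tuple X) / int}.

Definition tuple_chain (X : choiceType) (n : nat) (x : (n.+2).-tuple X) :
    chain X n := << x >>.

Section Faces.
Variables (X : Type) (T : X -> X -> X -> X).

Definition coordinate (m : nat) (x : m.+1.-tuple X) (k : nat) : X :=
  tnth x (inord k).

(* [face_left_from x i m] is d^L_{i,k} for k = i + 1 - m: the recursion defining
   d^L_{i,k} descends from k = i + 1. *)
Fixpoint face_left_from (x : nat -> X) (i m : nat) : X :=
  if m is m'.+1
  then T (x (i - m').-1%N) (x (i - m')%N) (face_left_from x i m')
  else x i.+1.

Definition face_left_at (x : nat -> X) (i k : nat) : X :=
  if (i < k)%N then x k else face_left_from x i (i.+1 - k)%N.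

Fixpoint face_right_at (x : nat -> X) (i k : nat) : X :=
  if k is k'.+1
  then if (k <= i)%N then x k else T (face_right_at x i k') (x k) (x k.+1)
  else x 0%N.

(* The faces d_i^{n+1,L} and d_i^{n+1,R}. *)
Definition face_left (n i : nat) (x : n.+3.-tuple X) : n.+2.-tuple X :=
  [tuple face_left_at (coordinate x) i k.+1 | k < n.+2].

Definition face_right (n i : nat) (x : n.+3.-tuple X) : n.+2.-tuple X :=
  [tuple face_right_at (coordinate x) i k | k < n.+2].

(* x[j] *)
Definition replace_at (m : nat) (x : m.+1.-tuple X) (j : nat) : m.+1.-tuple X :=
  [tuple if k == j :> nat
         then T (coordinate x j.-1) (coordinate x j) (coordinate x j.+1)
         else coordinate x k | k < m.+1].

End Faces.

(* The differential from degree n + 1 to degree n. *)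
Definition bd (X : choiceType) (T : X -> X -> X -> X) (n : nat) :
    chain X n.+1 -> chain X n :=
  fglift (fun x : n.+3.-tuple X =>
    \sum_(i < n.+2)
      (-1) ^+ i *:
        (tuple_chain (face_left T i x) - tuple_chain (face_right T i x))).

Inductive spanned (V : zmodType) (G : set V) : set V :=
| spanned0 : spanned G 0
| spanned_gen v : G v -> spanned G v
| spannedB u v : spanned G u -> spanned G v -> spanned G (u - v).

Definition gen_involutory (X : choiceType) (T : X -> X -> X -> X) (n : nat) :
    set (chain X n) :=
  [set z | exists x : (n.+2).-tuple X, exists2 j : nat,
     (1 <= j <= n)%N & z = tuple_chain x + tuple_chain (replace_at T x j)].

Definition gen_degenerate (X : choiceType) (L Q : X -> X -> X -> X) (n : nat) :
    set (chain X n) :=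
  [set z | exists x : (n.+2).-tuple X, exists2 j : nat,
     (1 <= j <= n)%N &
     z = tuple_chain x /\
     exists a b : X,
       [/\ coordinate x j.-1 = a, coordinate x j = b
         & coordinate x j.+1 = Q a b b] \/
       [/\ coordinate x j.-1 = L b b a, coordinate x j = b
         & coordinate x j.+1 = a]].

Definition chainI (X : choiceType) (T : X -> X -> X -> X) (n : nat) :
    set (chain X n) :=
  if n is 0 then [set 0] else spanned (gen_involutory T (n := n)).

Definition chainID (X : choiceType) (T L Q : X -> X -> X -> X) (n : nat) :
    set (chain X n) :=
  if n is 0 then [set 0]
  else spanned (gen_involutory T (n := n) `|` gen_degenerate L Q (n := n)).

(* The boundaries of the quotient complex C(X) / N(X) in degree n + 1, lifted
   to C_{n+1}(X). *)
Definition boundaries (X : choiceType) (T : X -> X -> X -> X)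
    (N : forall n, set (chain X n)) (n : nat) : set (chain X n.+1) :=
  [set z | exists w : chain X n.+2, N n.+1 (z - bd T w)].

(* The class of a cycle z in the homology of C(X) / N(X) in degree n + 1, as a
   coset in C_{n+1}(X). *)
Definition homology_class (X : choiceType) (T : X -> X -> X -> X)
    (N : forall n, set (chain X n)) (n : nat) (z : chain X n.+1) :
    set (chain X n.+1) :=
  [set z' | boundaries T N (z' - z)].

(** * Oriented surfaces *)

(* Charts take values in R^2 or, around boundary points, in the half-plane
   y >= 0.  [coord] and [coord_inv] are total functions whose values off
   [chart_dom], resp. off its image, are irrelevant. *)
Record chart (R : realType) (F : topologicalType) := Chart {
  chart_dom : set F;
  coord :> F -> 'rV[R]_2;
  coord_inv : 'rV[R]_2 -> F;
  dom_open : open chart_dom;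
  coordK : forall p, chart_dom p -> coord_inv (coord p) = p;
  coord_continuous : forall p, chart_dom p -> {for p, continuous coord};
  coord_inv_continuous : {within coord @` chart_dom, continuous coord_inv};
  coord_image : open (coord @` chart_dom) \/
    exists2 W, open W &
      coord @` chart_dom = W `&` [set v : 'rV[R]_2 | 0 <= v 0 1] }.

Definition interior_at (R : realType) (F : topologicalType) (c : chart R F)
    (p : F) : Prop :=
  interior (c @` chart_dom c) (c p).

Definition compatible (R : realType) (F : topologicalType)
    (c c' : chart R F) : Prop :=
  forall p, chart_dom c p -> chart_dom c' p ->
    (interior_at c p <-> interior_at c' p) /\
    (interior_at c p ->
     let transition : 'rV[R]_2 -> 'rV[R]_2 := c' \o coord_inv c in
     [/\ differentiable transition (c p),
         {for c p, continuous (jacobian transition)} &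
         0 < \det (jacobian transition (c p))]).

(* An oriented surface, possibly with boundary, with a maximal oriented atlas of
   class C^1.  Nothing is asked of the transition maps at boundary points
   besides continuity: all curves below lie in the interior. *)
Record oriented_surface (R : realType) := OrientedSurface {
  points :> topologicalType;
  surface_hausdorff : hausdorff_space points;
  atlas : set (chart R points);
  atlas_cover : forall p, exists2 c, atlas c & chart_dom c p;
  atlas_compatible : forall c c', atlas c -> atlas c' -> compatible c c';
  atlas_maximal : forall c,
    (forall c', atlas c' -> compatible c c' /\ compatible c' c) -> atlas c }.

Arguments atlas {R} _ _.

(* The determinant of (u, v): positive when v points to the left of u. *)
Definition det2 (R : realType) (u v : 'rV[R]_2) : R :=
  u 0 0 * v 0 1 - u 0 1 * v 0 0.

(** * Oriented flat link diagrams *)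

(* The pairs (component, time) at which a family of 1-periodic curves passes
   through p. *)
Definition passages (R : realType) (F : Type) (m : nat)
    (curve : 'I_m -> R -> F) (p : F) : set ('I_m * R) :=
  [set b | 0 <= b.2 < 1 /\ curve b.1 b.2 = p].

Definition multiple_points (R : realType) (F : Type) (m : nat)
    (curve : 'I_m -> R -> F) : set F :=
  [set p | exists b1 b2 : 'I_m * R,
     [/\ passages curve p b1, passages curve p b2 & b1 <> b2]].

Record diagram (R : realType) (F : oriented_surface R) := Diagram {
  components : nat;
  curve : 'I_components -> R -> F;
  curve_periodic : forall i t, curve i (t + 1) = curve i t;
  curve_continuous : forall i, continuous (curve i);
  curve_interior : forall i t c, atlas F c -> chart_dom c (curve i t) ->
    interior_at c (curve i t);
  curve_immersed : forall i t c, atlas F c -> chart_dom c (curve i t) ->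
    let g : R -> 'rV[R]_2 := c \o curve i in
    [/\ \forall s \near t, derivable g s 1, {for t, continuous (derive1 g)}
      & derive1 g t <> 0];
  multiple_points_finite : finite_set (multiple_points curve);
  multiple_points_double : forall p b1 b2 b3,
    passages curve p b1 -> passages curve p b2 -> passages curve p b3 ->
    [\/ b1 = b2, b1 = b3 | b2 = b3];
  multiple_points_transverse : forall p b1 b2 c,
    passages curve p b1 -> passages curve p b2 -> b1 <> b2 ->
    atlas F c -> chart_dom c p ->
    det2 (derive1 (c \o curve b1.1 : R -> 'rV[R]_2) b1.2)
         (derive1 (c \o curve b2.1 : R -> 'rV[R]_2) b2.2) <> 0 }.

Arguments curve {R F} _ _ _.

Definition underlying (R : realType) (F : oriented_surface R) (D : diagram F) :
    set F :=
  [set p | exists i t, curve D i t = p].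

Definition crossings (R : realType) (F : oriented_surface R) (D : diagram F) :
    set F :=
  multiple_points (curve D).

(* The positive tangent vectors of D at p, read in the chart c.  They determine
   D near p as an oriented curve up to reparametrization: the set is empty off
   D, an open ray at a simple point, and the union of two at a crossing. *)
Definition tangents (R : realType) (F : oriented_surface R) (D : diagram F)
    (c : chart R F) (p : F) : set 'rV[R]_2 :=
  [set w | exists i t (r : R),
     [/\ curve D i t = p, 0 < r
       & w = r *: derive1 (c \o curve D i : R -> 'rV[R]_2) t]].

(** * Colorings *)

(* A coloring is given by its values at the points of F; the values on the
   curves of the diagram are irrelevant.

   The corners at a crossing p: if u, v are positive tangents with v to the left
   of u, so that u points up-right and v up-left when both strands are drawn
   upward, then the corner (s1, s2) lies in the direction s1 u + s2 v. *)
Definition corner_color (R : realType) (F : oriented_surface R) (D : diagram F)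
    (X : choiceType) (col : F -> X) (p : F) (s1 s2 : R) : set X :=
  [set x | exists c u v,
     [/\ atlas F c /\ chart_dom c p, tangents D c p u, tangents D c p v,
         0 < det2 u v
       & \forall r \near 0^'+,
           col (coord_inv c (c p + r *: (s1 *: u + s2 *: v))) = x]].

(* At a crossing [corner_color] is a singleton, so that the default value of
   [xget] is not used. *)
Definition corner (R : realType) (F : oriented_surface R) (D : diagram F)
    (X : choiceType) (col : F -> X) (s1 s2 : R) (p : F) : X :=
  xget (col p) (corner_color D col p s1 s2).

Definition corner_left (R : realType) (F : oriented_surface R) (D : diagram F)
    (X : choiceType) (col : F -> X) (p : F) : X := corner D col (-1) 1 p.
Definition corner_bottom (R : realType) (F : oriented_surface R)
    (D : diagram F) (X : choiceType) (col : F -> X) (p : F) : X :=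
  corner D col (-1) (-1) p.
Definition corner_right (R : realType) (F : oriented_surface R) (D : diagram F)
    (X : choiceType) (col : F -> X) (p : F) : X := corner D col 1 (-1) p.
Definition corner_top (R : realType) (F : oriented_surface R) (D : diagram F)
    (X : choiceType) (col : F -> X) (p : F) : X := corner D col 1 1 p.

Definition coloring (R : realType) (F : oriented_surface R) (D : diagram F)
    (X : choiceType) (T : X -> X -> X -> X) (col : F -> X) : Prop :=
  (forall p q, connected_component (~` underlying D) p q -> col p = col q) /\
  (forall p, crossings D p ->
     corner_top D col p =
     T (corner_left D col p) (corner_bottom D col p) (corner_right D col p)).

Definition agree_off (R : realType) (F : oriented_surface R)
    (D D' : diagram F) (X : choiceType) (col col' : F -> X) (U : set F) :
    Prop :=
  forall p, ~ U p -> ~ underlying D p -> ~ underlying D' p -> col p = col' p.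

Definition diagram_chain (R : realType) (F : oriented_surface R)
    (D : diagram F) (X : choiceType) (col : F -> X) : chain X 1 :=
  \sum_(p \in crossings D)
    tuple_chain [tuple corner_left D col p; corner_bottom D col p;
                 corner_right D col p].

(** * Flat Reidemeister moves *)

Definition vec2 (R : realType) (x y : R) : 'rV[R]_2 :=
  \row_(j < 2) (if j == 0 then x else y).

(* An unoriented tangle with n strands in the square [-1, 1]^2, strand k < n
   being parametrized by [-1, 1]; it avoids the horizontal sides of the
   square. *)
Definition tangle (R : realType) (n : nat) (s : nat -> R -> 'rV[R]_2) : Prop :=
  forall k x, (k < n)%N -> -1 <= x <= 1 ->
    [/\ derivable (s k) x 1, `|s k x 0 0| <= 1 & `|s k x 0 1| < 1].

(* The positive tangent vectors at q of a tangle, strand k being traversed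
   backwards when [rev k] holds. *)
Definition tangle_tangents (R : realType) (n : nat) (s : nat -> R -> 'rV[R]_2)
    (rev : nat -> bool) (q : 'rV[R]_2) : set 'rV[R]_2 :=
  [set w | exists k x (r : R),
     [/\ (k < n)%N, -1 <= x <= 1, s k x = q, 0 < r
       & w = r *: ((-1) ^+ rev k *: derive1 (s k) x)]].

Definition graphs (R : realType) (f : nat -> R -> R) (k : nat) (x : R) :
    'rV[R]_2 := vec2 x (f k x).

(* The strand t |-> (t^2, w t) enters and leaves through the side x = 1.  Its
   double points come from the t > 0 with w (- t) = w t. *)
Definition move1 (R : realType) (s s' : nat -> R -> 'rV[R]_2) : Prop :=
  exists w w' : R -> R,
    [/\ forall t, s 0%N t = vec2 (t ^+ 2) (w t),
        forall t, s' 0%N t = vec2 (t ^+ 2) (w' t),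
        forall t, 0 < t <= 1 -> w (- t) < w t &
        exists a : R,
          [/\ 0 < a < 1,
              forall t, 0 < t < a -> w' t < w' (- t),
              w' (- a) = w' a,
              derive1 w' a + derive1 w' (- a) <> 0 &
              forall t, a < t <= 1 -> w' (- t) < w' t]].

Definition move2 (R : realType) (s s' : nat -> R -> 'rV[R]_2) : Prop :=
  exists f g : nat -> R -> R,
    [/\ s = graphs f,
        s' = graphs g,
        forall x, -1 <= x <= 1 -> f 0%N x < f 1%N x &
        exists a b : R,
          [/\ [/\ -1 < a, a < b & b < 1],
              forall x, -1 <= x < a \/ b < x <= 1 -> g 0%N x < g 1%N x,
              forall x, a < x < b -> g 1%N x < g 0%N x,
              g 0%N a = g 1%N a /\ derive1 (g 0%N) a <> derive1 (g 1%N) a &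
              g 0%N b = g 1%N b /\ derive1 (g 0%N) b <> derive1 (g 1%N) b]].

Definition cross_once_at (R : realType) (f g : R -> R) (x0 : R) : Prop :=
  [/\ -1 < x0 < 1,
      forall x, -1 <= x < x0 -> f x < g x,
      f x0 = g x0,
      derive1 f x0 <> derive1 g x0 &
      forall x, x0 < x <= 1 -> g x < f x].

(* Three strands reversing their vertical order, each pair crossing once: going
   from left to right the crossings are met in the order 01, 02, 12 before the
   move and 12, 02, 01 after it. *)
Definition move3 (R : realType) (s s' : nat -> R -> 'rV[R]_2) : Prop :=
  exists f g : nat -> R -> R,
    [/\ s = graphs f,
        s' = graphs g,
        exists x01 x02 x12 : R,
          [/\ cross_once_at (f 0%N) (f 1%N) x01,
              cross_once_at (f 0%N) (f 2%N) x02,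
              cross_once_at (f 1%N) (f 2%N) x12,
              x01 < x02 & x02 < x12] &
        exists x01 x02 x12 : R,
          [/\ cross_once_at (g 0%N) (g 1%N) x01,
              cross_once_at (g 0%N) (g 2%N) x02,
              cross_once_at (g 1%N) (g 2%N) x12,
              x12 < x02 & x02 < x01]].

(* The local pictures of the n-th Reidemeister move; they have n strands with
   the same ends before and after the move. *)
Definition local_move (R : realType) (n : nat) (s s' : nat -> R -> 'rV[R]_2) :
    Prop :=
  [/\ tangle n s, tangle n s',
      forall k, (k < n)%N -> s k (-1) = s' k (-1) /\ s k 1 = s' k 1 &
      match n with
      | 1 => move1 s s'
      | 2 => move2 s s'
      | 3 => move3 s s'
      | _ => False
      end].

(* Inside the disk, the preimage of the square [-1, 1]^2 (the unit ball of the
   norm of 'rV[R]_2) under a positively oriented chart, D and D' are the two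
   local pictures with the same orientations of the strands, in either order;
   outside, D and D' are the same oriented curves. *)
Definition flat_move (R : realType) (F : oriented_surface R) (n : nat)
    (D D' : diagram F) (U : set F) : Prop :=
  exists (c : chart R F) (s s' : nat -> R -> 'rV[R]_2) (rev : nat -> bool),
    [/\ [/\ atlas F c,
            [set v : 'rV[R]_2 | `|v| <= 1] `<=` interior (c @` chart_dom c)
          & U = [set p | chart_dom c p /\ `|c p| <= 1]],
        local_move n s s' \/ local_move n s' s,
        forall p, U p -> tangents D c p = tangle_tangents n s rev (c p),
        forall p, U p -> tangents D' c p = tangle_tangents n s' rev (c p)
      & forall p c', ~ U p -> atlas F c' -> chart_dom c' p ->
          tangents D c' p = tangents D' c' p].

(* Main.v *)
(* A crossing contributes the colors of three of its four corners, and these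
   colors only depend on the germ of the diagram: in a chart, the diagram stays
   away from any direction which is not tangent to it, so each corner has a
   well-defined color, which moreover does not depend on the chart.  Crossings
   off the disk hence contribute equally before and after a move.  Inside the
   disk the strands are explicit, and the complementary regions are strips
   between consecutive strands, so that every corner is matched with a region
   touching the boundary of the disk, where both colorings agree, or with an
   inner region.  A first move creates a crossing whose bottom and top corners
   have the same color, that is, a degenerate tuple (a, b, R(a, b, b)).  The two
   crossings of a second move contribute (a, b, c) and (a, T(a, b, c), c).  The
   two sides of a third move differ by the boundary of one quadruple, modulo C^I
   when the three strands are cyclically oriented. *)

Require Import Defs.
From HB Require Import structures.
From mathcomp Require Import all_boot all_order all_algebra.
From mathcomp Require Import freeg.
From mathcomp Require Import all_classical all_reals all_analysis.
From mathcomp Require Import ring lra.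

Set Implicit Arguments.
Unset Strict Implicit.
Unset Printing Implicit Defensive.

Import Order.TTheory GRing.Theory Num.Theory.
Import numFieldNormedType.Exports.

Local Open Scope classical_set_scope.
Local Open Scope ring_scope.

(** * The algebra of chains *)

Section Chains.
Variables (X : choiceType) (T L Q : X -> X -> X -> X).

(** A move is given through sets of positive tangent vectors, not through parametrized curves, so
    crossings and corners are first recharacterized by tangents alone. The analytic obstacle is
    [corner]: [xget] may return a color read in any chart, and a transition map, merely C^1, bends
    the straight ray of one chart into a curve of another. A ray that avoids the diagram is
    therefore not enough; a cone of directions is needed, uniformly in the radius, together with a
    sweep from one direction of a sector to another. Both come from compactness of [[0, 1]], for the
    time and for the sweeping parameter. Inside the disk, a strip between graphs is named by the set
    of strands below it, so regions are handled as finite sets and compared at the vertical sides of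
    the square. Orientations enter only through [turned], which permutes the four colors at a
    crossing; the geometry is thus done once, and the orientations of the strands are enumerated in
    pure algebra. For the third move the chain is forced: the six faces of a quadruple are the
    triples at the six crossings of the two triangles. *)

Lemma spannedN (V : zmodType) (G : set V) u : spanned G u -> spanned G (- u).
Proof. by move=> Gu; rewrite -sub0r; apply: spannedB => //; exact: spanned0. Qed.

Lemma spanned_sub (V : zmodType) (G H : set V) :
  G `<=` H -> spanned G `<=` spanned H.
Proof.
move=> GH u; elim=> [|v /GH Hv|v w _ Hv _ Hw].
- exact: spanned0.
- exact: spanned_gen.
- exact: spannedB.
Qed.

Lemma chainI_sub_ID n : chainI T (n := n) `<=` chainID T L Q (n := n).
Proof. by case: n => // n; apply: spanned_sub => z; left. Qed.

Lemma bdB n : {morph bd T (n := n) : u v / u - v}.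
Proof. exact: lift_is_additive. Qed.

Lemma homology_class_eq (N : forall n, set (chain X n)) n z z' :
  (forall u v, N n.+1 u -> N n.+1 v -> N n.+1 (u - v)) ->
  boundaries T N (z - z') ->
  homology_class T N z = homology_class T N (n := n) z'.
Proof.
move=> NB [w hw]; apply/seteqP.
(* The hypothesis provides an element of [N]; stability under subtraction then yields zero,
   opposites and sums. *)
have N0 : N n.+1 0 by rewrite -(subrr (z - z' - bd T w)); exact: NB.
have ND u v : N n.+1 u -> N n.+1 v -> N n.+1 (u + v).
  by move=> Nu Nv; rewrite -[v]opprK -[- v]sub0r; apply: (NB) => //; exact: NB.
have bd0 : bd T 0 = 0 :> chain X n.+1 by rewrite -(subrr 0) bdB subrr.
split=> y [v hv].
- exists (v - (0 - w)); rewrite !bdB bd0 sub0r opprK.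
  by rewrite -(subrKA z y) opprD addrACA; exact: ND.
- exists (v - w); rewrite bdB.
  have -> : y - z - (bd T v - bd T w) = y - z' - bd T v - (z - z' - bd T w).
    by rewrite !opprB [bd T w + (z' - z)]addrC [RHS]addrACA subrKA [- bd T v + _]addrC.
  exact: NB.
Qed.

Definition triple (a b c : X) : chain X 1 := tuple_chain [tuple a; b; c].

Lemma coordinate_triple (a b c : X) (k : nat) :
  (k < 3)%N -> coordinate [tuple a; b; c] k = nth a [:: a; b; c] k.
Proof. by move=> k3; rewrite /coordinate (tnth_nth a) inordK. Qed.

Lemma triple_involutory a b c :
  chainI T (n := 1) (triple a b c + triple a (T a b c) c).
Proof.
apply: spanned_gen; exists [tuple a; b; c], 1%N => //; congr (_ + << _ >>).
apply: eq_from_tnth => k; rewrite tnth_mktuple !coordinate_triple //.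
by case: k => [[|[|[|]]]] //= k3; rewrite (tnth_nth a).
Qed.

Lemma triple_degenerate a b : chainID T L Q (n := 1) (triple a b (Q a b b)).
Proof.
apply: spanned_gen; right; exists [tuple a; b; Q a b b], 1%N => //.
by split=> //; exists a, b; left; rewrite !coordinate_triple.
Qed.

(** For three parallel strands, with [x0], ..., [x3] the colors met when crossing them one after the
    other, the three positive faces are the triples on one side of a third move and the three
    negative faces those on the other side. *)
Lemma bd_quad x0 x1 x2 x3 :
  bd T (n := 1) (tuple_chain [tuple x0; x1; x2; x3]) =
  triple x1 x2 x3 - triple x0 (T x0 x1 x2) (T (T x0 x1 x2) x2 x3)
  - (triple (T x0 x1 x2) x2 x3 - triple x0 x1 (T x1 x2 x3))
  + (triple (T x0 x1 (T x1 x2 x3)) (T x1 x2 x3) x3 - triple x0 x1 x2).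
Proof.
rewrite /bd /tuple_chain liftU scale1r !big_ord_recl big_ord0 /= addr0.
have E (k : nat) : (k < 4)%N ->
    coordinate [tuple x0; x1; x2; x3] k = nth x0 [:: x0; x1; x2; x3] k.
  by move=> k4; rewrite /coordinate (tnth_nth x0) inordK.
rewrite /bump /= expr0 scale1r expr1 scaleN1r sqrrN expr1n scale1r.
have faceE (f g : 3.-tuple X) : (forall k : 'I_3, tnth f k = nth x0 g k) -> f = g.
  by move=> fg; apply: eq_from_tnth => k; rewrite fg (tnth_nth x0).
have L0 : face_left T 0 [tuple x0; x1; x2; x3] = [tuple x1; x2; x3].
  by apply: faceE => -[[|[|[|]]]] //= k3; rewrite tnth_mktuple /face_left_at /= ?E.
have R0 : face_right T 0 [tuple x0; x1; x2; x3]
    = [tuple x0; T x0 x1 x2; T (T x0 x1 x2) x2 x3].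
  by apply: faceE => -[[|[|[|]]]] //= k3; rewrite tnth_mktuple /= ?E.
have L1 : face_left T 1 [tuple x0; x1; x2; x3] = [tuple T x0 x1 x2; x2; x3].
  by apply: faceE => -[[|[|[|]]]] //= k3; rewrite tnth_mktuple /face_left_at /= ?E.
have R1 : face_right T 1 [tuple x0; x1; x2; x3] = [tuple x0; x1; T x1 x2 x3].
  by apply: faceE => -[[|[|[|]]]] //= k3; rewrite tnth_mktuple /= ?E.
have L2 : face_left T 2 [tuple x0; x1; x2; x3]
    = [tuple T x0 x1 (T x1 x2 x3); T x1 x2 x3; x3].
  by apply: faceE => -[[|[|[|]]]] //= k3; rewrite tnth_mktuple /face_left_at /= ?E.
have R2 : face_right T 2 [tuple x0; x1; x2; x3] = [tuple x0; x1; x2].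
  by apply: faceE => -[[|[|[|]]]] //= k3; rewrite tnth_mktuple /= ?E.
by rewrite addrA L0 R0 L1 R1 L2 R2.
Qed.

(* The unordered picture at a crossing of two strands drawn from left to right:
   [N], [W], [S], [E] are the colors of the corners, and [b1], [b2] tell whether
   the strand of lower, resp. higher, slope is oriented backwards.  The
   components are the left, bottom, right and top corners. *)
Definition turned (A : Type) (b1 b2 : bool) (N W S E : A) : A * A * A * A :=
  match b1, b2 with
  | false, false => (N, W, S, E)
  | true, false => (W, S, E, N)
  | true, true => (S, E, N, W)
  | false, true => (E, N, W, S)
  end.

Definition crossing_rule (b1 b2 : bool) (N W S E : X) : Prop :=
  let: (a, b, c, d) := turned b1 b2 N W S E in d = T a b c.

Definition crossing_chain (b1 b2 : bool) (N W S E : X) : chain X 1 :=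
  let: (a, b, c, _) := turned b1 b2 N W S E in triple a b c.

Lemma boundariesN (N : forall n, set (chain X n)) n z :
  (forall u v, N n.+1 u -> N n.+1 v -> N n.+1 (u - v)) ->
  boundaries T N z -> boundaries T N (n := n) (- z).
Proof.
(* This is [- w] written with subtractions only, which [bdB] carries through the differential. *)
move=> NB [w hw]; exists (w - w - w).
have N0 : N n.+1 0 by rewrite -(subrr (z - bd T w)); exact: NB.
by rewrite !bdB subrr sub0r opprK addrC -opprB -sub0r; exact: NB.
Qed.

Hypothesis hX : iktq T L Q.

Lemma iktqK a b c : T a (T a b c) c = b.
Proof. by case: hX => -[_ TK _] _ _; case: (TK a b c). Qed.

Lemma iktq_right a b c : Q a b (T a b c) = c.
Proof. by case: hX => -[_ _ TK] _ _; case: (TK a b c). Qed.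

(** For every orientation the two crossings have the same left and right corners, and the bottom
    corner of one is the top corner of the other: the triples are some x and x[1]. *)
Lemma bigon_chain (r0 r1 : bool) (N W S E : X) :
  crossing_rule r1 r0 N W S E ->
  chainI T (n := 1)
    (crossing_chain r1 r0 N W S E + crossing_chain r0 r1 N E S W).
Proof.
by case: r0 r1 => [] []; rewrite /crossing_chain /crossing_rule /= => H;
  rewrite [X in _ + triple _ X _]H; exact: triple_involutory.
Qed.

(* In six of the eight orientations the difference is, up to sign, the boundary
   of the quadruple of consecutive outer colors which starts with the region to
   the left of all strands.  In the two cyclic orientations the quadruple runs
   through both inner colors, and the boundary is the difference modulo C^I. *)
Lemma triangle_chain (r0 r1 r2 : bool) (h0 h1 h2 h3 h4 h5 Y Y' : X) :
  crossing_rule r1 r0 h1 h2 h3 Y -> crossing_rule r2 r0 h0 h1 Y h5 ->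
  crossing_rule r2 r1 h5 Y h3 h4 ->
  crossing_rule r2 r1 h0 h1 h2 Y' -> crossing_rule r2 r0 Y' h2 h3 h4 ->
  crossing_rule r1 r0 h0 Y' h4 h5 ->
  boundaries T (chainI T)
    (crossing_chain r1 r0 h1 h2 h3 Y + crossing_chain r2 r0 h0 h1 Y h5
     + crossing_chain r2 r1 h5 Y h3 h4
     - (crossing_chain r2 r1 h0 h1 h2 Y' + crossing_chain r2 r0 Y' h2 h3 h4
        + crossing_chain r1 r0 h0 Y' h4 h5)).
Proof.
have NI u v : chainI T (n := 1) u -> chainI T (n := 1) v ->
    chainI T (n := 1) (u - v) by exact: spannedB.
have I0 (z : chain X 1) : z = 0 -> chainI T (n := 1) z.
  by move=> ->; exact: spanned0.
case: r0 r1 r2 => [] [] []; rewrite /crossing_chain /crossing_rule /=;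
  move=> /esym E1 /esym E2 /esym E3 /esym E4 /esym E5 /esym E6.
- rewrite -opprB; apply: boundariesN => //.
  exists (tuple_chain [tuple h3; h4; h5; h0]).
  rewrite bd_quad ?(E1, E2, E3, E4, E5, E6); apply: I0.
  by apply/eqP/freeg_eqP => k; rewrite !(coeffD, coeffN) coeff0; ring.
- exists (tuple_chain [tuple h4; h5; h0; h1]).
  rewrite bd_quad ?(E1, E2, E3, E4, E5, E6); apply: I0.
  by apply/eqP/freeg_eqP => k; rewrite !(coeffD, coeffN) coeff0; ring.
(* Cyclic case: the middle strand runs against the other two. Four faces are triples of crossings;
   the other two are x[1] for the remaining triples x, with the opposite sign. [F1] and [F2]
   recognize them by undoing a crossing rule. *)
- rewrite -opprB; apply: boundariesN => //.
  exists (tuple_chain [tuple Y; h3; h4; Y']).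
  have F1 : T Y h3 h2 = h1 by rewrite -E1 iktqK.
  have F2 : T h5 h4 Y' = h0 by rewrite -E6 iktqK.
  rewrite bd_quad ?(E1, E2, E3, E4, E5, E6, F1, F2).
  have := NI _ _ (triple_involutory h5 h0 Y') (triple_involutory Y h1 h2).
  rewrite ?(E1, E2, E3, E4, E5, E6, F1, F2); congr (chainI _ _).
  by apply/eqP/freeg_eqP => k; rewrite !(coeffD, coeffN); ring.
- rewrite -opprB; apply: boundariesN => //.
  exists (tuple_chain [tuple h5; h0; h1; h2]).
  rewrite bd_quad ?(E1, E2, E3, E4, E5, E6); apply: I0.
  by apply/eqP/freeg_eqP => k; rewrite !(coeffD, coeffN) coeff0; ring.
- exists (tuple_chain [tuple h2; h3; h4; h5]).
  rewrite bd_quad ?(E1, E2, E3, E4, E5, E6); apply: I0.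
  by apply/eqP/freeg_eqP => k; rewrite !(coeffD, coeffN) coeff0; ring.
- exists (tuple_chain [tuple Y'; h2; h3; Y]).
  have F1 : T h4 h3 Y = h5 by rewrite -E3 iktqK.
  have F2 : T Y' h2 h1 = h0 by rewrite -E4 iktqK.
  rewrite bd_quad ?(E1, E2, E3, E4, E5, E6, F1, F2).
  have := NI _ _ (triple_involutory h4 h5 Y) (triple_involutory Y' h0 h1).
  rewrite ?(E1, E2, E3, E4, E5, E6, F1, F2); congr (chainI _ _).
  by apply/eqP/freeg_eqP => k; rewrite !(coeffD, coeffN); ring.
- rewrite -opprB; apply: boundariesN => //.
  exists (tuple_chain [tuple h1; h2; h3; h4]).
  rewrite bd_quad ?(E1, E2, E3, E4, E5, E6); apply: I0.
  by apply/eqP/freeg_eqP => k; rewrite !(coeffD, coeffN) coeff0; ring.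
- exists (tuple_chain [tuple h0; h1; h2; h3]).
  rewrite bd_quad ?(E1, E2, E3, E4, E5, E6); apply: I0.
  by apply/eqP/freeg_eqP => k; rewrite !(coeffD, coeffN) coeff0; ring.
Qed.

End Chains.

(** * Tangents and crossings *)

Section Tangents.
Variables (R : realType) (F : oriented_surface R).
Implicit Types (D : diagram F) (c : chart R F) (p : F).
Local Notation plane := 'rV[R]_2.
Local Notation domain_interior c := (interior (c @` chart_dom c)).

Lemma det2_cvg (I : Type) (G : set_system I) {FG : Filter G}
    (f g : I -> plane) u v :
  f x @[x --> G] --> u -> g x @[x --> G] --> v ->
  det2 (f x) (g x) @[x --> G] --> det2 u v.
Proof.
move=> fu gv.
have coordE (h : I -> plane) (w : plane) (j : 'I_2) : h x @[x --> G] --> w ->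
    h x 0 j @[x --> G] --> w 0 j.
  by move=> hw; apply: (@cvg_comp _ _ _ h (fun M : plane => M 0 j) _ _ _ hw);
    exact: matrix_normedtype.coord_continuous.
by apply: cvgB; apply: cvgM; apply: coordE.
Qed.

Lemma det2Zl a (u v : plane) : det2 (a *: u) v = a * det2 u v.
Proof. by rewrite /det2 !mxE; ring. Qed.

Lemma det2Zr a (u v : plane) : det2 u (a *: v) = a * det2 u v.
Proof. by rewrite /det2 !mxE; ring. Qed.

Lemma det2vv (u : plane) : det2 u u = 0.
Proof. by rewrite /det2; ring. Qed.

Lemma det2C (u v : plane) : det2 u v = - det2 v u.
Proof. by rewrite /det2; ring. Qed.

Lemma det2Dl (u v w : plane) : det2 (u + v) w = det2 u w + det2 v w.
Proof. by rewrite /det2 !mxE; ring. Qed.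

Lemma det2_mulmx (u v : plane) (M : 'M[R]_2) :
  det2 (u *m M) (v *m M) = det2 u v * \det M.
Proof.
rewrite (expand_det_row M 0) !big_ord_recl big_ord0 /cofactor !det_mx11 !mxE.
rewrite /det2 !mxE !big_ord_recl !big_ord0 /= addr0.
have l01 : fintype.lift ord0 ord0 = 1 :> 'I_2 by exact: val_inj.
have l10 : fintype.lift 1 ord0 = 0 :> 'I_2 by exact: val_inj.
by rewrite !l01 !l10 /= expr0 expr1; ring.
Qed.

Lemma coord_invK c q : (c @` chart_dom c) q ->
  chart_dom c (coord_inv c q) /\ c (coord_inv c q) = q.
Proof. by case=> p cp <-; rewrite coordK. Qed.

Lemma coord_inv_continuous_at c q :
  domain_interior c q -> {for q, continuous (coord_inv c)}.
Proof.
move=> iq; have /subspace_continuousP := @coord_inv_continuous _ _ c.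
move=> /(_ q (interior_subset iq)); rewrite within_interior //.
Qed.

Lemma curve_int D i t (n : int) : curve D i (t + n%:~R) = curve D i t.
Proof.
have nat_case s (m : nat) : curve D i (s + m%:R) = curve D i s.
  elim: m => [|m IH]; first by rewrite addr0.
  by rewrite -addn1 natrD addrA curve_periodic.
case: n => n; first exact: nat_case.
by rewrite NegzE rmorphN /= -[in RHS](subrK (n.+1%:R : R) t) nat_case.
Qed.

Lemma derive1_curve_int D i t (n : int) (c : F -> plane) :
  derive1 (c \o curve D i : R -> plane) (t + n%:~R) =
  derive1 (c \o curve D i : R -> plane) t.
Proof.
have E : (fun h : R => h^-1 *: ((c \o curve D i) (h + (t + n%:~R))
             - (c \o curve D i) (t + n%:~R))) =
    (fun h : R => h^-1 *: ((c \o curve D i) (h + t) - (c \o curve D i) t)).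
  by apply/funext => h /=; rewrite addrA !curve_int.
by rewrite /derive1 E.
Qed.

Lemma frac_itv (t : R) : exists2 n : int, 0 <= t + n%:~R < 1 & True.
Proof.
exists (- Num.floor t) => //; rewrite rmorphN /= subr_ge0 ltrBlDl.
by have := floor_itv t; rewrite rmorphD /=.
Qed.

(** By periodicity the curves form a finite union of continuous images of [[0, 1]], which are
    compact, hence closed in a Hausdorff space. *)
Lemma closed_underlying D : closed (underlying D).
Proof.
have -> : underlying D =
    \bigcup_(i in [set: 'I_(components D)]) (curve D i @` `[0, 1]).
  apply/seteqP; split=> p.
    case=> i [t <-]; have [n /andP[n0 n1] _] := frac_itv t.
    exists i => //; exists (t + n%:~R); last exact: curve_int.
    by rewrite /= in_itv /= n0 ltW.
  by case=> i _ [t _ <-]; exists i, t.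
apply: closed_bigcup => [|i _]; first exact: finite_finset.
apply: compact_closed.
  exact: surface_hausdorff.
apply: continuous_compact; last exact: segment_compact.
by apply: continuous_subspaceT => t; exact: curve_continuous.
Qed.

Lemma tangentsP D c p z : tangents D c p z <->
  exists b r, [/\ passages (curve D) p b, 0 < r &
    z = r *: derive1 (c \o curve D b.1 : R -> plane) b.2].
Proof.
split=> [[i [t [r [<- r0 ->]]]]|[[i t] [r [[_ /= <-] r0 ->]]]]; last by exists i, t, r.
have [n n01 _] := frac_itv t; exists (i, t + n%:~R), r; split.
  by split=> /=; [exact: n01|exact: curve_int].
  exact: r0.
by rewrite /= derive1_curve_int.
Qed.

Lemma tangents_underlying D c p z : tangents D c p z -> underlying D p.
Proof. by case=> i [t [_ [<- _ _]]]; exists i, t. Qed.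

(** Transversality makes the tangents of two distinct passages independent, and exchanging them
    fixes the sign. Conversely, all tangents of a single passage are parallel. Hence diagrams with
    the same tangents at a point have the same crossing there. *)
Lemma crossingsP D c p : atlas F c -> chart_dom c p ->
  crossings D p <->
  exists u v, [/\ tangents D c p u, tangents D c p v & 0 < det2 u v].
Proof.
move=> ac cp; split.
  move=> [[i1 t1] [[i2 t2] [P1 P2 ne]]].
  have /eqP := multiple_points_transverse P1 P2 ne ac cp.
  have [/= _ E1] := P1; have [/= _ E2] := P2.
  set u := derive1 _ _; set v := derive1 _ _.
  have tu : tangents D c p u by exists i1, t1, 1; rewrite scale1r.
  have tv : tangents D c p v by exists i2, t2, 1; rewrite scale1r.
  rewrite neq_lt => /orP[uv|uv]; last by exists u, v.
  by exists v, u; rewrite det2C oppr_gt0.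
move=> [u [v [/tangentsP[b1 [r1 [P1 r10 ->]]] /tangentsP[b2 [r2 [P2 r20 ->]]]]]].
move=> uv; exists b1, b2; split=> // bb.
by move: uv; rewrite bb det2Zl det2Zr det2vv !mulr0 ltxx.
Qed.

Lemma tangents_two D c p u v z :
  tangents D c p u -> tangents D c p v -> tangents D c p z -> 0 < det2 u v ->
  (exists2 l : R, 0 < l & z = l *: u) \/ (exists2 m : R, 0 < m & z = m *: v).
Proof.
(* All tangents of a passage [b] are multiples of one vector [d b]; once it is abstracted, equal
   passages give parallel tangents by substitution. *)
have [d tanP] : exists d : 'I_(components D) * R -> plane, forall z,
    tangents D c p z ->
    exists b r, [/\ passages (curve D) p b, 0 < r & z = r *: d b].
  by eexists => y /tangentsP; exact.
move=> /tanP[b1 [r1 [P1 r10 ->]]] /tanP[b2 [r2 [P2 r20 ->]]].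
move=> /tanP[b3 [r3 [P3 r30 ->]]].
have [->|b13 _|b23 _] := multiple_points_double P1 P2 P3.
- by rewrite det2Zl det2Zr det2vv !mulr0 ltxx.
- left; exists (r3 / r1); first exact: divr_gt0.
  by rewrite scalerA mulfVK ?gt_eqF // b13.
- right; exists (r3 / r2); first exact: divr_gt0.
  by rewrite scalerA mulfVK ?gt_eqF // b23.
Qed.

(** The tangents fill two open rays, and exchanging the rays would reverse the sign of [det2]. *)
Lemma tangents_unique D c p u v u1 v1 :
  tangents D c p u -> tangents D c p v -> tangents D c p u1 -> tangents D c p v1 ->
  0 < det2 u v -> 0 < det2 u1 v1 ->
  exists l m : R, [/\ 0 < l, 0 < m, u1 = l *: u & v1 = m *: v].
Proof.
move=> tu tv tu1 tv1 uv.
have [[l l0 ->]|[l l0 ->]] := tangents_two tu tv tu1 uv;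
  have [[m m0 ->]|[m m0 ->]] := tangents_two tu tv tv1 uv.
- by rewrite det2Zl det2Zr det2vv !mulr0 ltxx.
- by exists l, m.
- by rewrite det2Zl det2Zr det2C !pmulr_rgt0 // oppr_gt0 ltNge (ltW uv).
- by rewrite det2Zl det2Zr det2vv !mulr0 ltxx.
Qed.

End Tangents.

(** * Directions avoiding the diagram near a point, and colors along paths *)

Section Cone.
Variables (R : realType) (F : oriented_surface R).
Implicit Types (D : diagram F) (c : chart R F) (p : F).
Local Notation plane := 'rV[R]_2.
Local Notation domain_interior c := (interior (c @` chart_dom c)).

Lemma tangent_interior D c p z :
  atlas F c -> chart_dom c p -> tangents D c p z -> domain_interior c (c p).
Proof.
by move=> ac cp [i [t [_ [E _ _]]]]; move: cp; rewrite -E; exact: curve_interior.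
Qed.

Lemma ray_cvg (q w : plane) :
  q + x.1 *: x.2 @[x --> filter_prod (0 : R)^'+ (nbhs w)] --> q.
Proof.
rewrite -[X in _ --> X]addr0 -(scale0r w).
apply: cvgD; first exact: cvg_cst.
apply: cvgZ; last exact: cvg_snd.
by apply: cvg_trans cvg_fst _; exact: cvg_within.
Qed.

(* On a curve through p, c - c p is asymptotically parallel to the tangent, so
   the curve avoids a cone around any other direction w. *)
Lemma off_tangent_cone D c p (w : plane) :
  atlas F c -> chart_dom c p -> domain_interior c (c p) -> w != 0 ->
  (forall z, tangents D c p z -> det2 w z <> 0) ->
  \forall r \near (0 : R)^'+ & w' \near w,
    domain_interior c (c p + r *: w') /\
    ~ underlying D (coord_inv c (c p + r *: w')).
Proof.
move=> ac cp icp w0 offw.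
pose G := filter_prod (0 : R)^'+ (nbhs w).
have GI : \forall x \near G, domain_interior c (c p + x.1 *: x.2).
  by apply: ray_cvg; apply: open_nbhs_nbhs; split=> //; exact: open_interior.
suff H : \forall x \near G, forall i : 'I_(components D),
    `[0, 1] `<=` [set t | curve D i t <> coord_inv c (c p + x.1 *: x.2)].
  apply: filterS2 GI H => -[r w'] /= Ix Hx; split=> // -[i [t E]].
  have [n /andP[n0 n1] _] := frac_itv t.
  apply: (Hx i (t + n%:~R)); first by rewrite /= in_itv /= n0 ltW.
  by rewrite curve_int.
apply: filter_forall => i.
have /compact_near_coveringP := @segment_compact R 0 1.
apply=> t0 _.
have [E|/eqP ne] := pselect (curve D i t0 = p); last first.
  have := @surface_hausdorff R F; rewrite open_hausdorff => /(_ _ _ ne).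
  case=> -[A B] /= [/set_mem At /set_mem Bp] [oA oB /eqP AB].
  have NA : \forall t \near t0, A (curve D i t).
    by apply: curve_continuous; exact: open_nbhs_nbhs.
  have NB : \forall x \near G, B (coord_inv c (c p + x.1 *: x.2)).
    have NBq : \forall q \near c p, B (coord_inv c q).
      apply: (coord_inv_continuous_at icp).
      by rewrite coordK //; exact: open_nbhs_nbhs.
    exact: (@ray_cvg (c p) w _ NBq).
  near=> t x => /= txE.
  have : (A `&` B) (curve D i t).
    by split; [near: t|rewrite txE; near: x].
  by rewrite AB.
pose g : R -> plane := c \o curve D i.
pose z := derive1 g t0.
have dz : det2 w z <> 0.
  by apply: offw; exists i, t0, 1; rewrite scale1r.
have cvg_z : h^-1 *: (g (h + t0) - g t0) @[h --> 0^'] --> z.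
  have := @curve_immersed _ _ D i t0 c ac; rewrite E => /(_ cp) /= [dg _ _].
  have {}dg := nbhs_singleton dg.
  rewrite /z derive1E; move: dg; rewrite /derivable /derive /=.
  by under eq_fun do rewrite [_ *: 1]mulr1.
(* If the curve met the cone at time [t0 + h], its difference quotient would be parallel to [x.2]
   and this determinant would vanish. *)
have NZ : \forall h \near 0^' & x \near G,
    det2 x.2 (h^-1 *: (g (h + t0) - g t0)) != 0.
  have : det2 y.2.2 (y.1^-1 *: (g (y.1 + t0) - g t0))
      @[y --> filter_prod 0^' G] --> det2 w z.
    apply: det2_cvg.
      by apply: cvg_comp cvg_snd _; exact: cvg_snd.
    apply: (@cvg_comp _ _ _ fst (fun h : R => h^-1 *: (g (h + t0) - g t0))
      _ _ _ cvg_fst); exact: cvg_z.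
  move=> /(_ [set d : R | d != 0]); apply.
  by apply: open_nbhs_nbhs; split; [exact: open_neq|exact/eqP].
case: NZ => -[A B] /= [NA NB] AB.
have NA' : \forall t \near t0, t != t0 -> A (t - t0).
  have : (t - t0) @[t --> t0] --> 0.
    by rewrite -(subrr t0); apply: cvgB; [exact: cvg_id|exact: cvg_cst].
  move=> /(_ _ NA) NA0; near=> t => tt0.
  suff : t - t0 != 0 -> A (t - t0) by apply; rewrite subr_eq0.
  by near: t; exact: NA0.
have NW : \forall x \near G, x.2 != 0.
  have NW1 : \forall y \near w, y != 0.
    have := @det2_cvg R plane (nbhs w) (nbhs_filter w) (fun y => y) (fun=> z) w z (@cvg_id _ _)
      (@cvg_cst _ z plane (nbhs w) (nbhs_filter w)).
    move=> /(_ [set d : R | d != 0]) NW2; near=> y.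
    suff : det2 y z != 0.
      by apply: contra_neq => ->; rewrite -(scale0r z) det2Zl mul0r.
    near: y; apply: NW2.
    by apply: open_nbhs_nbhs; split; [exact: open_neq|exact/eqP].
  exists (setT, [set y : plane | y != 0]) => [|[r y] [_ /=]//].
  by split=> //=; exact: filterT.
have NR : \forall x \near G, 0 < x.1.
  exists ([set r : R | 0 < r], setT) => [|[r y] [/= ? _]//].
  by split=> /=; [exact: nbhs_right_gt|exact: filterT].
have NC : \forall t \near t0, chart_dom c (curve D i t).
  by apply: curve_continuous; rewrite E; apply: open_nbhs_nbhs; split=> //; exact: dom_open.
near=> t x => /= txE.
have gtE : g t = c p + x.1 *: x.2.
  have [] : chart_dom c (curve D i t) /\ c (coord_inv c (c p + x.1 *: x.2)) = c p + x.1 *: x.2.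
    split; first by near: t.
    by apply: (coord_invK _).2; apply: interior_subset; near: x.
  by rewrite /g /= txE.
have x20 : x.2 != 0 by near: x.
have x10 : 0 < x.1 by near: x.
(* At [t0] itself there is no difference quotient, but there the curve is at [p], whereas
   [x.1 *: x.2] is nonzero. *)
have [tt0|tt0] := eqVneq t t0.
  move: gtE; rewrite tt0 /g /= E => /esym/eqP.
  by rewrite -subr_eq0 addrAC subrr add0r scaler_eq0 gt_eqF //= (negbTE x20).
have /= := AB (t - t0, x); rewrite subrK gtE /g /= E.
rewrite addrAC subrr add0r scalerA det2Zr det2vv mulr0 eqxx.
move=> /(_ _)/negP; apply => //.
have tA : A (t - t0) by move: tt0; near: t.
by split; [exact: tA|near: x].
Unshelve. all: by end_near.
Qed.

Lemma coloring_path D (X : choiceType) (T : X -> X -> X -> X) (col : F -> X) c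
    (g : R -> plane) (a b : R) :
  coloring D T col -> a <= b -> {within `[a, b], continuous g} ->
  (forall x, a <= x <= b ->
     domain_interior c (g x) /\ ~ underlying D (coord_inv c (g x))) ->
  col (coord_inv c (g a)) = col (coord_inv c (g b)).
Proof.
move=> [colD _] ab gab Hg; apply: colD.
pose h := coord_inv c \o g.
have mem_a : [set` `[a, b]] a by rewrite /= in_itv /= lexx.
have mem_b : [set` `[a, b]] b by rewrite /= in_itv /= lexx ab.
apply: (@connected_component_max _ _ (h @` `[a, b])); first by exists a.
- by move=> _ [x xab <-]; apply: (Hg x _).2; move: xab; rewrite /= in_itv.
- apply: connected_continuous_connected; first exact: segment_connected.
  apply/subspace_continuousP => x xab.
  move/subspace_continuousP: gab => /(_ x xab) gx.
  apply: (cvg_comp _ _ gx); apply: coord_inv_continuous_at.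
  by apply: (Hg x _).1; move: xab; rewrite /= in_itv.
- by exists b.
Qed.

Lemma coloring_segment D (X : choiceType) (T : X -> X -> X -> X) (col : F -> X)
    c (q1 q2 : plane) :
  coloring D T col ->
  (forall x : R, 0 <= x <= 1 ->
     domain_interior c (q1 + x *: (q2 - q1)) /\
     ~ underlying D (coord_inv c (q1 + x *: (q2 - q1)))) ->
  col (coord_inv c q1) = col (coord_inv c q2).
Proof.
move=> colD Hq.
have := @coloring_path D X T col c (fun x => q1 + x *: (q2 - q1)) 0 1 colD ler01.
rewrite scale0r addr0 scale1r (addrC q1 (q2 - q1)) subrK; apply=> //.
apply: continuous_subspaceT => x.
by apply: cvgD; [exact: cvg_cst|apply: cvgZ; [exact: cvg_id|exact: cvg_cst]].
Qed.

End Cone.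

(** * Colors of corners *)

Section Corners.
Variables (R : realType) (F : oriented_surface R).
Implicit Types (D : diagram F) (c : chart R F) (p : F).
Local Notation plane := 'rV[R]_2.
Local Notation domain_interior c := (interior (c @` chart_dom c)).

Lemma near_coord_inv_dom c c' p : chart_dom c p -> chart_dom c' p ->
  domain_interior c' (c' p) ->
  \forall q \near c' p, chart_dom c (coord_inv c' q).
Proof.
move=> cp c'p ic'p; apply: (coord_inv_continuous_at ic'p).
by rewrite coordK //; apply: open_nbhs_nbhs; split=> //; exact: dom_open.
Qed.

(** This is the chain rule; vectors are rows, so the Jacobian acts on the right. The curve read in
    [c] factors through the transition map only near [t], which suffices for the derivative. *)
Lemma transition_tangents D c c' p (z : plane) :
  atlas F c -> atlas F c' -> chart_dom c p -> chart_dom c' p ->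
  tangents D c' p z ->
  tangents D c p (z *m jacobian (c \o coord_inv c' : plane -> plane) (c' p)).
Proof.
move=> ac ac' cp c'p tz.
have ic'p : domain_interior c' (c' p) by exact: (tangent_interior ac' c'p tz).
have [_ /(_ ic'p)] := atlas_compatible ac' ac c'p cp.
set tr : plane -> plane := c \o coord_inv c' => -[dtr _ _].
case: tz => [i [t [r [E r0 ->]]]]; exists i, t, r; split=> //.
rewrite -scalemxAl; congr (_ *: _).
have := @curve_immersed _ _ D i t c' ac'; rewrite E => /(_ c'p) /= [dg _ _].
have {}dg := nbhs_singleton dg; move/derivable1_diffP: dg => dg.
set g : R -> plane := c' \o curve D i in dg *.
have gt : g t = c' p by rewrite /g /= E.
have -> : derive1 (c \o curve D i : R -> plane) t = derive1 (tr \o g) t.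
  rewrite !derive1E; apply: near_eq_derive.
  have : \forall s \near t, chart_dom c' (curve D i s).
    apply: curve_continuous; rewrite E; apply: open_nbhs_nbhs; split=> //.
    exact: dom_open.
  by apply: filterS => s c's; rewrite /tr /g /= coordK.
have dtr' : differentiable tr (g t) by rewrite gt.
rewrite !derive1E -deriveEjacobian // (deriveE _ (differentiable_comp dg dtr')).
by rewrite (diff_comp dg dtr') /= gt -(deriveE _ dg) deriveE.
Qed.

(** A straight ray of [c'] becomes a curve in [c]. Rescaled by the radius, it is a moving direction
    with a limit, the form in which [sector_color] accepts it. *)
Lemma transition_ray c c' p (w : plane) :
  atlas F c -> atlas F c' -> chart_dom c p -> chart_dom c' p ->
  domain_interior c' (c' p) ->
  r^-1 *: (c (coord_inv c' (c' p + r *: w)) - c p) @[r --> 0^'+] -->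
  w *m jacobian (c \o coord_inv c' : plane -> plane) (c' p).
Proof.
move=> ac ac' cp c'p ic'p; apply: cvg_dnbhs_at_right.
have [_ /(_ ic'p)] := atlas_compatible ac' ac c'p cp.
set tr : plane -> plane := c \o coord_inv c' => -[dtr _ _].
have := @diff_derivable _ _ _ tr (c' p) w dtr.
rewrite /derivable -deriveEjacobian // /derive /tr /= coordK //.
by under eq_fun do rewrite [_ + c' p]addrC.
Qed.

Lemma corner_direction D c p (u v : plane) (s1 s2 : R) :
  tangents D c p u -> tangents D c p v -> 0 < det2 u v -> s1 != 0 -> s2 != 0 ->
  s1 *: u + s2 *: v != 0 /\
  forall z, tangents D c p z -> det2 (s1 *: u + s2 *: v) z <> 0.
Proof.
move=> tu tv uv s10 s20.
have Eu : det2 (s1 *: u + s2 *: v) u = - (s2 * det2 u v).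
  by rewrite det2Dl !det2Zl det2vv mulr0 add0r [det2 v u]det2C mulrN.
have Ev : det2 (s1 *: u + s2 *: v) v = s1 * det2 u v.
  by rewrite det2Dl !det2Zl det2vv mulr0 addr0.
have uv0 : det2 u v != 0 by rewrite gt_eqF.
split=> [|z tz].
  apply/eqP => w0; move/eqP: Ev; rewrite w0 -(scale0r u) det2Zl mul0r eq_sym.
  by rewrite mulf_eq0 (negbTE s10) (negbTE uv0).
apply/eqP; have [[l l0 ->]|[l l0 ->]] := tangents_two tu tv tz uv.
  by rewrite det2Zr Eu mulrN oppr_eq0 !mulf_eq0 (gt_eqF l0) (negbTE s20) (negbTE uv0).
by rewrite det2Zr Ev !mulf_eq0 (gt_eqF l0) (negbTE s10) (negbTE uv0).
Qed.

Variables (X : choiceType) (T : X -> X -> X -> X).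

(* Sweeping the direction from w to w1 never meets the diagram near p. *)
Lemma sector_color D (col : F -> X) c p (w w1 : plane) (W : R -> plane) :
  coloring D T col -> atlas F c -> chart_dom c p -> domain_interior c (c p) ->
  (forall x : R, 0 <= x <= 1 -> w + x *: (w1 - w) != 0 /\
     forall z, tangents D c p z -> det2 (w + x *: (w1 - w)) z <> 0) ->
  W r @[r --> 0^'+] --> w1 ->
  \forall r \near (0 : R)^'+,
    col (coord_inv c (c p + r *: w)) = col (coord_inv c (c p + r *: W r)).
Proof.
move=> colD ac cp icp Hw Ww1.
have /compact_near_coveringP := @segment_compact R 0 1.
move=> /(_ _ (0 : R)^'+ (fun r x =>
  domain_interior c (c p + r *: (w + x *: (W r - w))) /\
  ~ underlying D (coord_inv c (c p + r *: (w + x *: (W r - w)))))) cover.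
have {cover} : \forall r \near (0 : R)^'+, [set` `[0, 1]] `<=` (fun x : R =>
  domain_interior c (c p + r *: (w + x *: (W r - w))) /\
  ~ underlying D (coord_inv c (c p + r *: (w + x *: (W r - w))))).
  (* Around each swept direction there is a whole cone off the diagram, which absorbs the gap
     between [W r] and its limit [w1]. *)
  apply: cover => x; rewrite /= in_itv /= => x01.
  have [wx0 offwx] := Hw x x01.
  have [[A B] /= [NA NB] AB] := off_tangent_cone ac cp icp wx0 offwx.
  have lim : w + y.1 *: (W y.2 - w) @[y --> filter_prod (nbhs x) (0 : R)^'+]
      --> w + x *: (w1 - w).
    apply: cvgD; first exact: cvg_cst.
    apply: cvgZ; first exact: cvg_fst.
    apply: cvgB; last exact: cvg_cst.
    by apply: cvg_comp Ww1; exact: cvg_snd.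
  have NA' : \forall y \near filter_prod (nbhs x) (0 : R)^'+, A y.2.
    by exists (setT, A) => [|[y r] [_ /=]//]; split=> //=; exact: filterT.
  have NB' := lim _ NB.
  apply: filterS2 NA' NB' => -[y r] /= Ar Br.
  exact: (AB (_, _)).
apply: filterS => r Hr.
apply: (coloring_segment colD) => x x01.
have -> : c p + r *: w + x *: (c p + r *: W r - (c p + r *: w)) =
    c p + r *: (w + x *: (W r - w)).
  by apply/rowP => j; rewrite !mxE; ring.
by apply: Hr; rewrite /= in_itv.
Qed.

(** The value chosen by [xget] comes from some chart [c'] and some tangents [u'], [v']. Transported
    to [c], these are positive multiples of [u] and [v], so the bent ray of [c'] tends to a
    direction in the same sector as the ray of [c], and sweeping the sector identifies the
    colors. *)
Lemma corner_eq D (col : F -> X) c p (u v : plane) (s1 s2 : R) x :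
  coloring D T col -> atlas F c -> chart_dom c p ->
  tangents D c p u -> tangents D c p v -> 0 < det2 u v -> s1 != 0 -> s2 != 0 ->
  (\forall r \near (0 : R)^'+,
     col (coord_inv c (c p + r *: (s1 *: u + s2 *: v))) = x) ->
  corner D col s1 s2 p = x.
Proof.
move=> colD ac cp tu tv uv s10 s20 Hx.
have : corner_color D col p s1 s2 (corner D col s1 s2 p).
  by apply: (@xgetI _ _ _ x); exists c, u, v.
move: (corner D col s1 s2 p) => y [c' [u' [v' [[ac' c'p] tu' tv' uv' Hy]]]].
have icp := tangent_interior ac cp tu.
have ic'p := tangent_interior ac' c'p tu'.
set J := jacobian (c \o coord_inv c' : plane -> plane) (c' p).
have detJ : 0 < \det J.
  by have [_ /(_ ic'p)[]] := atlas_compatible ac' ac c'p cp.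
have tu1 := transition_tangents ac ac' cp c'p tu'.
have tv1 := transition_tangents ac ac' cp c'p tv'.
have uv1 : 0 < det2 (u' *m J) (v' *m J) by rewrite det2_mulmx mulr_gt0.
have [l [m [l0 m0 Eu Ev]]] := tangents_unique tu tv tu1 tv1 uv uv1.
have := transition_ray (w := s1 *: u' + s2 *: v') ac ac' cp c'p ic'p.
rewrite -/J mulmxDl -!scalemxAl /J Eu Ev => lim.
have := sector_color colD ac cp icp _ lim.
set w := s1 *: u + s2 *: v.
move=> /(_ w) H.
have {}H := H _.
have HC : \forall r \near (0 : R)^'+,
    chart_dom c (coord_inv c' (c' p + r *: (s1 *: u' + s2 *: v'))).
  have : c' p + r *: (s1 *: u' + s2 *: v') @[r --> (0 : R)^'+] -->
      c' p + 0 *: (s1 *: u' + s2 *: v').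
    apply: cvgD; first exact: cvg_cst.
    by apply: cvgZ; [apply: cvg_within|exact: cvg_cst].
  rewrite scale0r addr0.
  move=> /(_ [set q | chart_dom c (coord_inv c' q)]); apply.
  exact: near_coord_inv_dom.
have H' : \forall r \near (0 : R)^'+, x = y.
  have H0 : \forall r \near (0 : R)^'+, 0 < r by exact: nbhs_right_gt.
  near=> r.
  have r0 : 0 < r by near: r.
  have <- : col (coord_inv c (c p + r *: w)) = x by near: r.
  have -> : col (coord_inv c (c p + r *: w)) = col (coord_inv c (c p + r *:
     (r^-1 *: (c (coord_inv c' (c' p + r *: (s1 *: u' + s2 *: v'))) - c p)))).
    near: r; apply: H => t /andP[t0 t1].
    (* The factors 1 + t (l - 1) and 1 + t (m - 1) are convex combinations of 1 with [l], resp. [m],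
       hence positive: the sweep never reaches a tangent direction. *)
    have -> : w + t *: (s1 *: (l *: u) + s2 *: (m *: v) - w) =
        (s1 * (1 + t * (l - 1))) *: u + (s2 * (1 + t * (m - 1))) *: v.
      by apply/rowP => j; rewrite /w !mxE; ring.
    apply: corner_direction => //; rewrite mulf_neq0 // gt_eqF //; nra.
  rewrite scalerA divff ?gt_eqF // scale1r addrC subrK coordK; last by near: r.
  by near: r.
by have [] := @filter_ex _ _ _ _ H'.
Unshelve. all: by end_near.
Qed.

(** A short open ray into the corner is connected and off the diagram, so it has a single color,
    sampled at radius [e / 2]; [corner_eq] says that this color is the corner. *)
Lemma corner_exists D (col : F -> X) c p (u v : plane) (s1 s2 : R) :
  coloring D T col -> atlas F c -> chart_dom c p ->
  tangents D c p u -> tangents D c p v -> 0 < det2 u v -> s1 != 0 -> s2 != 0 ->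
  \forall r \near (0 : R)^'+,
    ~ underlying D (coord_inv c (c p + r *: (s1 *: u + s2 *: v))) /\
    col (coord_inv c (c p + r *: (s1 *: u + s2 *: v))) = corner D col s1 s2 p.
Proof.
move=> colD ac cp tu tv uv s10 s20.
set w := s1 *: u + s2 *: v.
have icp := tangent_interior ac cp tu.
have [w0 offw] := corner_direction tu tv uv s10 s20.
have [[A B] /= [NA NB] AB] := off_tangent_cone ac cp icp w0 offw.
have [e /= e0 He] : exists2 e : R, 0 < e & forall r, 0 < r < e ->
    domain_interior c (c p + r *: w) /\ ~ underlying D (coord_inv c (c p + r *: w)).
  case: NA => e /= e0 He; exists e => // r /andP[r0 re].
  apply: (AB (r, w)); split; last exact: nbhs_singleton.
  by apply: He => //=; rewrite sub0r normrN gtr0_norm.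
have cst r : 0 < r < e -> col (coord_inv c (c p + r *: w)) =
    col (coord_inv c (c p + (e / 2) *: w)).
  have path a b : 0 < a -> a <= b -> b < e ->
      col (coord_inv c (c p + a *: w)) = col (coord_inv c (c p + b *: w)).
    move=> a0 ab be; apply: (@coloring_path _ _ D X T col c (fun r => c p + r *: w)) => //.
      apply: continuous_subspaceT => y.
      by apply: cvgD; [exact: cvg_cst|apply: cvgZ; [exact: cvg_id|exact: cvg_cst]].
    by move=> y /andP[ay yb]; apply: He; rewrite (lt_le_trans a0) //= (le_lt_trans yb).
  move=> /andP[r0 re]; have [re2|/ltW e2r] := leP r (e / 2).
    by apply: path => //; lra.
  by apply/esym/path => //; lra.
have near_e : \forall r \near (0 : R)^'+, 0 < r < e.
  near=> r; apply/andP; split; near: r; [exact: nbhs_right_gt|exact: nbhs_right_lt].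
have -> : corner D col s1 s2 p = col (coord_inv c (c p + (e / 2) *: w)).
  apply: (corner_eq colD ac cp tu tv uv s10 s20).
  by apply: filterS near_e => r; exact: cst.
by apply: filterS near_e => r re; split; [apply: (He r re).2|exact: cst].
Unshelve. all: by end_near.
Qed.

End Corners.

(** * Diagrams in the square *)

Section Square.
Variables (R : realType) (F : oriented_surface R).
Implicit Types (D : diagram F) (c : chart R F) (p : F).
Local Notation plane := 'rV[R]_2.
Local Notation domain_interior c := (interior (c @` chart_dom c)).
Variables (X : choiceType) (T : X -> X -> X -> X).

Lemma norm_plane_le (v : plane) (m : R) : 0 <= m ->
  (`|v| <= m) = (`|v 0 0| <= m) && (`|v 0 1| <= m).
Proof.
move=> m0; rewrite /Num.norm /= mx_normrE; apply/bigmax_leP/andP.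
  by move=> [_ H]; split; [apply: (H (0, 0))|apply: (H (0, 1))].
move=> [H0 H1]; split=> // -[i j] _ /=; rewrite (ord1 i).
by have [->|->] : j = 0 \/ j = 1;
  [case: j => [[|[|]]] // ?; [left|right]; exact: val_inj|..].
Qed.

Lemma vec2_0 (x y : R) : vec2 x y 0 0 = x. Proof. by rewrite mxE. Qed.
Lemma vec2_1 (x y : R) : vec2 x y 0 1 = y. Proof. by rewrite mxE. Qed.

Lemma vec2_eta (v : plane) : v = vec2 (v 0 0) (v 0 1).
Proof.
apply/rowP => j; rewrite mxE.
by case: j => [[|[|]]] // ?; rewrite /=; congr (v 0 _); exact: val_inj.
Qed.

Lemma norm_vec2_le1 (x y : R) : (`|vec2 x y| <= 1) = (-1 <= x <= 1) && (-1 <= y <= 1).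
Proof. by rewrite norm_plane_le // vec2_0 vec2_1 !ler_norml. Qed.

Lemma vec2_cvg (I : Type) (G : set_system I) {FG : Filter G} (g h : I -> R) x y :
  g t @[t --> G] --> x -> h t @[t --> G] --> y ->
  vec2 (g t) (h t) @[t --> G] --> vec2 x y.
Proof.
have E (z w : R) : vec2 z w = z *: vec2 1 0 + w *: vec2 0 1.
  by apply/rowP => j; rewrite !mxE; case: ifP => _; ring.
move=> gx hy; rewrite E; have -> : (fun t => vec2 (g t) (h t)) =
    (fun t => g t *: vec2 1 0 + h t *: vec2 0 1) by apply/funext => t; exact: E.
by apply: cvgD; apply: cvgZ => //; exact: cvg_cst.
Qed.

Lemma near_right (P : set R) : (\forall r \near (0 : R)^'+, P r) <->
  exists2 e : R, 0 < e & forall r, 0 < r < e -> P r.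
Proof.
split=> [[e /= e0 He]|[e e0 He]].
  exists e => // r /andP[r0 re]; apply: He => //=.
  by rewrite sub0r normrN gtr0_norm.
near=> r; apply: He; apply/andP.
by split; near: r; [exact: nbhs_right_gt|exact: nbhs_right_lt].
Unshelve. all: by end_near.
Qed.

Section Outside.
Variables (D D' : diagram F) (col col' : F -> X) (U : set F).
Hypotheses (hcol : coloring D T col) (hcol' : coloring D' T col').
Hypothesis hagree : agree_off D D' col col' U.
Hypothesis tangents_off : forall p c, ~ U p -> atlas F c -> chart_dom c p ->
  tangents D c p = tangents D' c p.

Lemma crossings_off p : ~ U p -> crossings D p <-> crossings D' p.
Proof.
move=> Up; have [c ac cp] := atlas_cover p.
by rewrite !(crossingsP _ ac cp) (tangents_off Up ac cp).
Qed.

(** The tangents at [p] are common, so one ray points into the given corner for both diagrams. Since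
    [U] is closed, the ray stays off [U] near [p], where the colorings agree. *)
Lemma corner_off p (s1 s2 : R) : closed U -> ~ U p -> crossings D p ->
  s1 != 0 -> s2 != 0 -> corner D col s1 s2 p = corner D' col' s1 s2 p.
Proof.
move=> Ucl Up Dp s10 s20; have [c ac cp] := atlas_cover p.
have /(crossingsP _ ac cp)[u [v [tu tv uv]]] := Dp.
have E := tangents_off Up ac cp.
have tu' : tangents D' c p u by rewrite -E.
have tv' : tangents D' c p v by rewrite -E.
have H := corner_exists hcol ac cp tu tv uv s10 s20.
have H' := corner_exists hcol' ac cp tu' tv' uv s10 s20.
have icp := tangent_interior ac cp tu.
have HU : \forall r \near (0 : R)^'+, ~ U (coord_inv c (c p + r *: (s1 *: u + s2 *: v))).
  have NU : \forall q \near c p, ~ U (coord_inv c q).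
    move: (coord_inv_continuous_at icp) => /(_ (~` U)); apply; rewrite coordK //.
    by apply: open_nbhs_nbhs; split=> //; exact: closed_openC.
  have : c p + r *: (s1 *: u + s2 *: v) @[r --> (0 : R)^'+] -->
      c p + 0 *: (s1 *: u + s2 *: v).
    apply: cvgD; first exact: cvg_cst.
    by apply: cvgZ; [apply: cvg_within|exact: cvg_cst].
  by rewrite scale0r addr0 => /(_ [set q | ~ U (coord_inv c q)]); exact.
have : \forall r \near (0 : R)^'+, corner D col s1 s2 p = corner D' col' s1 s2 p.
  apply: filterS3 HU H H' => r nU [nD <-] [nD' <-].
  exact: hagree.
by case/filter_ex.
Qed.

End Outside.

Variable c : chart R F.
Hypothesis ac : atlas F c.
Hypothesis square : [set v : plane | `|v| <= 1] `<=` domain_interior c.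
Local Notation U := [set p | chart_dom c p /\ `|c p| <= 1].

Lemma square_point q : `|q| <= 1 ->
  [/\ U (coord_inv c q), chart_dom c (coord_inv c q) & c (coord_inv c q) = q].
Proof.
move=> q1; have [d e] := coord_invK (interior_subset (square q1)).
by split=> //; split=> //; rewrite e.
Qed.

(** The disk is the continuous image of a compact square. Being closed in the whole surface, and not
    only in the chart domain, it stays away from corners of crossings off the disk. *)
Lemma closed_disk : closed U.
Proof.
apply: compact_closed; first exact: surface_hausdorff.
have -> : U = coord_inv c @` [set v : plane | `|v| <= 1].
  apply/seteqP; split=> [p [cp p1]|_ [v v1 <-]]; first by exists (c p) => //; exact: coordK.
  by have [] := square_point v1.
apply: continuous_compact.
  apply/subspace_continuousP => q /square/coord_inv_continuous_at cq.
  by apply: cvg_trans cq; apply: cvg_app; exact: cvg_within.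
apply: bounded_closed_compact.
  by exists 1; split=> // M M1 v /= v1; exact: le_trans v1 (ltW M1).
have -> : [set v : plane | `|v| <= 1] = Num.norm @^-1` [set x : R | x <= 1] by [].
by apply: closed_comp; [move=> v _; exact: norm_continuous|exact: closed_le].
Qed.

(* A point of the boundary of the disk is close to points off the disk. *)
Lemma boundary_color D D' (col col' : F -> X) q :
  coloring D T col -> coloring D' T col' -> agree_off D D' col col' U ->
  `|q| = 1 -> ~ underlying D (coord_inv c q) -> ~ underlying D' (coord_inv c q) ->
  col (coord_inv c q) = col' (coord_inv c q).
Proof.
move=> colD colD' agree q1 qD qD'.
have iq : domain_interior c q by apply: square; rewrite /= q1.
have near_off (E : diagram F) : ~ underlying E (coord_inv c q) ->
    \forall q' \near q, ~ underlying E (coord_inv c q').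
  move=> qE; move: (coord_inv_continuous_at iq) => /(_ (~` underlying E)); apply.
  by apply: open_nbhs_nbhs; split=> //; apply: closed_openC; exact: closed_underlying.
have NI : \forall q' \near q, domain_interior c q'.
  by apply: open_nbhs_nbhs; split=> //; exact: open_interior.
have N : \forall t \near (0 : R), [/\ domain_interior c (q + t *: q),
    ~ underlying D (coord_inv c (q + t *: q)) &
    ~ underlying D' (coord_inv c (q + t *: q))].
  have : q + t *: q @[t --> (0 : R)] --> q + 0 *: q.
    apply: cvgD; first exact: cvg_cst.
    by apply: cvgZ; [exact: cvg_id|exact: cvg_cst].
  rewrite scale0r addr0 => lim.
  have lim' : \forall q' \near q, [/\ domain_interior c q',
    ~ underlying D (coord_inv c q') & ~ underlying D' (coord_inv c q')].
    apply: filterS3 NI (near_off _ qD) (near_off _ qD') => q' ? ? ?; by split.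
  exact: (lim _ lim').
have [e /= e0 He] := N.
have e20 : 0 < e / 2 by rewrite divr_gt0.
(* A radial push: its norm is 1 + e / 2, so it leaves the disk, yet it is close enough to [q] to
   remain in the chart and off both diagrams along the way. *)
pose q' := q + (e / 2) *: q.
have good x : 0 <= x <= 1 -> [/\ domain_interior c (q + x *: (q' - q)),
    ~ underlying D (coord_inv c (q + x *: (q' - q))) &
    ~ underlying D' (coord_inv c (q + x *: (q' - q)))].
  move=> /andP[x0 x1]; rewrite /q' addrAC subrr add0r scalerA; apply: He => /=.
  rewrite sub0r normrN ger0_norm; last by rewrite mulr_ge0 // ltW.
  by rewrite (@le_lt_trans _ _ (e / 2)) ?ler_piMl ?(ltW e20) //; lra.
rewrite (@coloring_segment _ _ D X T col c q q' colD); last by move=> x /good[].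
rewrite (@coloring_segment _ _ D' X T col' c q q' colD'); last by move=> x /good[].
have [] := good 1; first by rewrite ler01 lexx.
rewrite scale1r addrC subrK => iq' nD nD'.
apply: agree => //; rewrite /= (coord_invK (interior_subset iq')).2 => -[_].
rewrite /q' -[X in `|X + _|]scale1r -scalerDl normrZ q1 mulr1 ger0_norm; lra.
Qed.

Section Tangle.
Variables (D : diagram F) (col : F -> X).
Hypothesis colD : coloring D T col.
Variables (n : nat) (s : nat -> R -> plane) (rev : nat -> bool).
Hypothesis tangle_s : tangle n s.
Hypothesis tangents_s : forall p, U p -> tangents D c p = tangle_tangents n s rev (c p).

Lemma underlying_tangle q : `|q| <= 1 ->
  underlying D (coord_inv c q) <->
  exists k x, [/\ (k < n)%N, -1 <= x <= 1 & s k x = q].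
Proof.
move=> q1; have [Up cp E] := square_point q1; have := tangents_s Up; rewrite E => tE.
split=> [[i [t it]]|[k [x [kn x1 skx]]]].
  have : tangents D c (coord_inv c q)
      (derive1 (c \o curve D i : R -> plane) t) by exists i, t, 1; rewrite scale1r.
  by rewrite tE => -[k [x [r [kn x1 skx _ _]]]]; exists k, x.
suff : tangents D c (coord_inv c q) (1 *: ((-1) ^+ rev k *: derive1 (s k) x)).
  exact: tangents_underlying.
by rewrite tE; exists k, x, 1.
Qed.

Lemma square_path (g : R -> plane) (a b : R) : a <= b ->
  {within `[a, b], continuous g} -> (forall x, a <= x <= b -> `|g x| <= 1) ->
  (forall x k y, a <= x <= b -> (k < n)%N -> -1 <= y <= 1 -> s k y <> g x) ->
  col (coord_inv c (g a)) = col (coord_inv c (g b)).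
Proof.
move=> ab ga g1 gs; apply: (coloring_path colD) => // x xab.
split; first exact: square (g1 _ xab).
by move/(underlying_tangle (g1 _ xab)) => [k [y [kn y1]]]; exact: gs.
Qed.

End Tangle.

Section Graphs.
Variables (D : diagram F) (col : F -> X).
Hypothesis colD : coloring D T col.
Variables (n : nat) (f : nat -> R -> R) (rev : nat -> bool).
Hypothesis tangle_f : tangle n (graphs f).
Hypothesis tangents_f : forall p, U p ->
  tangents D c p = tangle_tangents n (graphs f) rev (c p).

Lemma graphs_derivable k x : (k < n)%N -> -1 <= x <= 1 ->
  [/\ derivable (f k) x 1, -1 < f k x < 1 &
      derive1 (graphs f k) x = vec2 1 (derive1 (f k) x)].
Proof.
move=> kn x1; have [dk _] := tangle_f kn x1.
rewrite vec2_1 ltr_norml => fk1.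
have /derivable_mxP dkj := dk.
have df : derivable (f k) x 1.
  by have := dkj 0 1; under eq_fun do rewrite vec2_1.
split=> //.
rewrite [LHS]vec2_eta derive1E derive_mx // !mxE; congr vec2.
  by under eq_fun do rewrite vec2_0; rewrite derive_id.
by rewrite derive1E; congr ('D_1 _ x); apply/funext => y; rewrite vec2_1.
Qed.

Definition col_at (x y : R) : X := col (coord_inv c (vec2 x y)).

(** A strip is named by the set of strands below it. The name makes sense over every abscissa and
    for both sides of a move, even where the strip is empty. *)
Definition in_region (sig : nat -> bool) (x y : R) : Prop :=
  -1 <= y <= 1 /\
  forall k, (k < n)%N -> if sig k then f k x < y else y < f k x.

Lemma in_region_path (sig : nat -> bool) (g h : R -> R) (a b : R) : a <= b ->
  {within `[a, b], continuous g} -> {within `[a, b], continuous h} ->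
  (forall t, a <= t <= b -> -1 <= g t <= 1 /\ in_region sig (g t) (h t)) ->
  col_at (g a) (h a) = col_at (g b) (h b).
Proof.
move=> ab ga ha H.
apply: (square_path colD tangents_f (g := fun t => vec2 (g t) (h t))) => //.
- apply/subspace_continuousP => x xab.
  move/subspace_continuousP: ga => /(_ x xab) gx.
  move/subspace_continuousP: ha => /(_ x xab) hx.
  exact: vec2_cvg gx hx.
- by move=> x /H[g1 [h1 _]]; rewrite norm_vec2_le1 g1 h1.
- move=> x k y /H[_ [_ /(_ k)]] + kn _ E.
  have Ex : y = g x by have := congr1 (fun v : plane => v 0 0) E; rewrite !vec2_0.
  have := congr1 (fun v : plane => v 0 1) E; rewrite !vec2_1 Ex => ->.
  by move=> /(_ kn); case: ifP; rewrite ltxx.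
Qed.

Lemma within_cst (A : set R) (y : R) : {within A, continuous (fun=> y)}.
Proof. by apply: continuous_subspaceT => x; exact: cvg_cst. Qed.

Lemma within_id (A : set R) : {within A, continuous (fun x : R => x)}.
Proof. by apply: continuous_subspaceT => x; exact: cvg_id. Qed.

Lemma region_vertical (sig : nat -> bool) (x y z : R) : -1 <= x <= 1 ->
  in_region sig x y -> in_region sig x z -> col_at x y = col_at x z.
Proof.
move=> x1; wlog yz : y z / y <= z => [H ry rz|ry rz].
  by case/orP: (le_total y z) => le; [exact: H|apply/esym; exact: H].
apply: (in_region_path (sig := sig) yz (g := fun=> x) (h := fun t => t)).
- exact: within_cst.
- exact: within_id.
- move=> t /andP[yt tz]; split=> //.
  have [/andP[y1 y2] Hy] := ry; have [/andP[z1 z2] Hz] := rz.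
  split=> [|k kn]; first by apply/andP; split; lra.
  by have := Hy k kn; have := Hz k kn; case: (sig k) => ? ?; lra.
Qed.

Lemma within_continuous_bigmax (A : set R) (sig : nat -> bool) (b : R) :
  (forall k, (k < n)%N -> {within A, continuous (f k)}) ->
  {within A, continuous (fun x => \big[Num.max/b]_(k < n | sig k) f k x)}.
Proof.
move=> fA.
suff H (r : seq 'I_n) : {within A, continuous
    (fun x => \big[Num.max/b]_(k <- r | sig k) f k x)} by exact: H.
elim: r => [|k r IH].
  by under eq_fun do rewrite big_nil; exact: within_cst.
under eq_fun do rewrite big_cons.
case: (sig k); last exact: IH.
move=> x; apply: (@continuous_max _ (subspace A)); [exact: fA|exact: IH].
Qed.

Lemma within_continuous_bigmin (A : set R) (sig : nat -> bool) (b : R) :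
  (forall k, (k < n)%N -> {within A, continuous (f k)}) ->
  {within A, continuous (fun x => \big[Num.min/b]_(k < n | sig k) f k x)}.
Proof.
move=> fA.
suff H (r : seq 'I_n) : {within A, continuous
    (fun x => \big[Num.min/b]_(k <- r | sig k) f k x)} by exact: H.
elim: r => [|k r IH].
  by under eq_fun do rewrite big_nil; exact: within_cst.
under eq_fun do rewrite big_cons.
case: (sig k); last exact: IH.
move=> x; apply: (@continuous_min _ (subspace A)); [exact: fA|exact: IH].
Qed.

(* The points above the strands k with [sig k] and below the other ones form a
   strip, connected as long as no strand of the first kind crosses one of the
   second kind. *)
Lemma region_color (sig : nat -> bool) (a b y z : R) :
  -1 <= a -> a <= b -> b <= 1 ->
  (forall x i j, a <= x <= b -> (i < n)%N -> (j < n)%N -> sig i -> ~~ sig j ->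
     f i x < f j x) ->
  in_region sig a y -> in_region sig b z -> col_at a y = col_at b z.
Proof.
move=> a1 ab b1 sep ry rz.
have fcont k : (k < n)%N -> {within `[a, b], continuous (f k)}.
  move=> kn; apply: derivable_within_continuous => x; rewrite in_itv /= => /andP[ax xb].
  by have [] := @graphs_derivable k x kn; first by apply/andP; split; lra.
(* Strands stay strictly between the heights -1 and 1, so these defaults matter only for a strip
   with no strand below, resp. above. The path joining the two points follows the middle of the
   strip. *)
pose lo x := \big[Num.max/-1]_(k < n | sig k) f k x.
pose up x := \big[Num.min/1]_(k < n | ~~ sig k) f k x.
pose mid x := 2^-1 * (lo x + up x).
have x1 x : a <= x <= b -> -1 <= x <= 1 by move=> /andP[? ?]; apply/andP; split; lra.
have loup x : a <= x <= b -> lo x < up x.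
  move=> xab; apply/bigmin_gtP; split=> [|j sj].
    apply/bigmax_ltP; split=> [|i si]; first lra.
    by have [_ /andP[]] := @graphs_derivable i x (ltn_ord i) (x1 _ xab).
  apply/bigmax_ltP; split=> [|i si]; last exact: sep.
  by have [_ /andP[]] := @graphs_derivable j x (ltn_ord j) (x1 _ xab).
have midr x : a <= x <= b -> in_region sig x (mid x).
  move=> xab; have lu := loup x xab.
  have lo1 : -1 <= lo x by exact: bigmax_ge_id.
  have up1 : up x <= 1 by exact: bigmin_le_id.
  split=> [|k kn]; first by rewrite /mid; apply/andP; split; lra.
  case: ifP => sk; rewrite /mid.
    have : f k x <= lo x by exact: (@le_bigmax_cond _ _ _ _ (Ordinal kn)
      (fun k : 'I_n => sig k) (fun k : 'I_n => f k x)).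
    lra.
  have : up x <= f k x by apply: (@bigmin_le_cond _ _ _ _ (Ordinal kn)
    (fun k : 'I_n => ~~ sig k) (fun k : 'I_n => f k x)); rewrite /= sk.
  lra.
have aab : a <= a <= b by rewrite lexx.
have bab : a <= b <= b by rewrite lexx ab.
rewrite (region_vertical (x1 _ aab) ry (midr _ aab)).
rewrite -(region_vertical (x1 _ bab) (midr _ bab) rz).
apply: (in_region_path (sig := sig) ab (g := fun t => t) (h := mid)).
- exact: within_id.
- move=> x; apply: cvgM; first exact: cvg_cst.
  apply: cvgD; first exact: within_continuous_bigmax.
  exact: (@within_continuous_bigmin _ (fun k => ~~ sig k)).
- by move=> t tab; split; [exact: x1|exact: midr].
Qed.

(** Tangents to graphs are nonzero multiples of (1, slope), so the determinant of two of them is a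
    nonzero multiple of the difference of the slopes. *)
Lemma graphs_crossing p : U p ->
  crossings D p <-> exists i j, [/\ (i < n)%N, (j < n)%N,
    c p = vec2 (c p 0 0) (f i (c p 0 0)), c p = vec2 (c p 0 0) (f j (c p 0 0)) &
    derive1 (f i) (c p 0 0) < derive1 (f j) (c p 0 0)].
Proof.
move=> Up; have [cp p1] := Up; rewrite (crossingsP _ ac cp) (tangents_f Up).
set x0 := c p 0 0.
have x01 : -1 <= x0 <= 1.
  by move: p1; rewrite norm_plane_le // => /andP[]; rewrite ler_norml.
split=> [[u [v [[k [x [r [kn x1 E r0 ->]]]] [l [y [t [ln y1 E' t0 ->]]]]]]]|].
  have Ex : x = x0 by rewrite /x0 -E vec2_0.
  have Ey : y = x0 by rewrite /x0 -E' vec2_0.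
  rewrite Ex in E x1; rewrite Ey in E' y1.
  rewrite Ex Ey.
  have [_ _ ->] := graphs_derivable kn x1; have [_ _ ->] := graphs_derivable ln y1.
  rewrite !det2Zl !det2Zr /det2 !vec2_0 !vec2_1 mul1r mulr1.
  have [H|H|H] := ltgtP (derive1 (f k) x0) (derive1 (f l) x0).
  - by exists k, l; split.
  - by exists l, k; split.
  - by rewrite H subrr !mulr0 ltxx.
move=> [i [j [iN jN Ei Ej ij]]].
have [_ _ di] := graphs_derivable iN x01; have [_ _ dj] := graphs_derivable jN x01.
have tk k : (k < n)%N -> c p = vec2 x0 (f k x0) ->
    derive1 (graphs f k) x0 = vec2 1 (derive1 (f k) x0) ->
    tangle_tangents n (graphs f) rev (c p)
      ((-1) ^+ rev k *: vec2 1 (derive1 (f k) x0)).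
  by move=> kn Ek dk; exists k, x0, 1; split=> //; rewrite dk scale1r.
pose w k : plane := (-1) ^+ rev k *: vec2 1 (derive1 (f k) x0).
have wij : det2 (w i) (w j) != 0.
  rewrite /w det2Zl det2Zr /det2 !vec2_0 !vec2_1 !mulf_neq0 ?signr_eq0 //.
  by rewrite mul1r mulr1 subr_eq0 gt_eqF.
have ti := tk i iN Ei di; have tj := tk j jN Ej dj.
move: wij; rewrite neq_lt => /orP[wij|wij]; last by exists (w i), (w j).
by exists (w j), (w i); rewrite det2C oppr_gt0.
Qed.

End Graphs.
End Square.

(** * Crossings of graphs *)

Section Slopes.
Variable R : realType.
Implicit Types (f g : R -> R) (x m : R).

Lemma dnbhs_right (P : set R) :
  (\forall h \near (0 : R)^', P h) -> \forall r \near (0 : R)^'+, P r /\ P (- r).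
Proof.
case=> e /= e0 He; apply/near_right; exists e => // r /andP[r0 re].
by split; apply: He => /=; rewrite ?sub0r ?opprK ?normrN ?gtr0_norm ?oppr_eq0 ?gt_eqF.
Qed.

Lemma nbhs_right_pm x (P : set R) :
  (\forall y \near x, P y) -> \forall r \near (0 : R)^'+, P (x + r) /\ P (x - r).
Proof.
case=> e /= e0 He; apply/near_right; exists e => // r /andP[r0 re].
split; apply: He => /=; first by rewrite opprD addNKr normrN gtr0_norm.
by rewrite opprB addrCA subrr addr0 gtr0_norm.
Qed.

Lemma near_right_scale (k : R) (P : set R) : 0 < k ->
  (\forall r \near (0 : R)^'+, P r) -> \forall r \near (0 : R)^'+, P (r * k).
Proof.
move=> k0 /near_right[e e0 He]; apply/near_right.
exists (e / k) => [|r /andP[r0 re]]; first exact: divr_gt0.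
by apply: He; rewrite mulr_gt0 //= -ltr_pdivlMr.
Qed.

Lemma slope_gt g x m : derivable g x 1 -> m < derive1 g x ->
  \forall r \near (0 : R)^'+, g x + m * r < g (x + r) /\ g (x - r) < g x - m * r.
Proof.
move=> dg mg.
have lim : h^-1 *: (g (h + x) - g x) @[h --> 0^'] --> derive1 g x.
  move: dg; rewrite derive1E /derivable /derive /=.
  by under eq_fun do rewrite [_ *: 1]mulr1.
have N : \forall h \near (0 : R)^', m < h^-1 *: (g (h + x) - g x).
  by apply: (lim [set y | m < y]); apply: open_nbhs_nbhs; split=> //; exact: open_gt.
have P0 : \forall r \near (0 : R)^'+, 0 < r by exact: nbhs_right_gt.
apply: filterS2 P0 (dnbhs_right N) => r r0 [/= Hp Hm].
split.
  move: Hp; rewrite /GRing.scale /= mulrC ltr_pdivlMr // [r + x]addrC; lra.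
move: Hm; rewrite /GRing.scale /= invrN mulNr -mulrN opprB mulrC ltr_pdivlMr //.
by rewrite [- r + x]addrC; lra.
Qed.

Lemma slope_lt g x m : derivable g x 1 -> derive1 g x < m ->
  \forall r \near (0 : R)^'+, g (x + r) < g x + m * r /\ g x - m * r < g (x - r).
Proof.
move=> dg mg.
have dNg : derivable (- g) x 1 by exact: derivableN.
have mNg : - m < derive1 (- g) x by rewrite derive1E (deriveN dg) -derive1E ltrN2.
apply: filterS (slope_gt dNg mNg) => r [/= Hp Hm].
by rewrite !fctE in Hp Hm; split; lra.
Qed.

(** If the slopes were in the opposite order, a line of intermediate slope through the common point
    would lie above [f] and below [g] just to the right of [x]. *)
Lemma slope_order f g x : derivable f x 1 -> derivable g x 1 -> f x = g x ->
  derive1 f x <> derive1 g x -> (\forall r \near (0 : R)^'+, g (x + r) <= f (x + r)) ->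
  derive1 g x < derive1 f x.
Proof.
move=> df dg fg ne H; have [//|lt|eq] := ltgtP (derive1 g x) (derive1 f x); last by case: ne.
pose m := 2^-1 * (derive1 f x + derive1 g x).
have fm : derive1 f x < m by rewrite /m; lra.
have gm : m < derive1 g x by rewrite /m; lra.
have : \forall r \near (0 : R)^'+, False.
  by apply: filterS3 H (slope_lt df fm) (slope_gt dg gm) => r ? [? _] [? _]; lra.
by case/filter_ex.
Qed.

Lemma lt_near f g x : derivable f x 1 -> derivable g x 1 -> f x < g x ->
  \forall r \near (0 : R)^'+, f (x + r) < g (x + r) /\ f (x - r) < g (x - r).
Proof.
move=> df dg fg; apply: (nbhs_right_pm (P := [set y | f y < g y])).
have cf : {for x, continuous f}.
  by move/derivable1_diffP: df => /differentiable_continuous.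
have cg : {for x, continuous g}.
  by move/derivable1_diffP: dg => /differentiable_continuous.
have lim : g y - f y @[y --> x] --> g x - f x by exact: cvgB.
have : \forall y \near x, 0 < g y - f y.
  apply: (lim [set z | 0 < z]); apply: open_nbhs_nbhs; split; first exact: open_gt.
  by rewrite /= subr_gt0.
by apply: filterS => y /=; rewrite subr_gt0.
Qed.

End Slopes.

Section GraphCrossing.
Variables (R : realType) (F : oriented_surface R).
Local Notation plane := 'rV[R]_2.
Local Notation domain_interior c := (interior (c @` chart_dom c)).
Variables (X : choiceType) (T : X -> X -> X -> X).
Variable c : chart R F.
Hypothesis ac : atlas F c.
Hypothesis square : [set v : plane | `|v| <= 1] `<=` domain_interior c.
Local Notation U := [set p | chart_dom c p /\ `|c p| <= 1].
Variables (D : diagram F) (col : F -> X).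
Hypothesis colD : coloring D T col.
Variables (n : nat) (f : nat -> R -> R) (rev : nat -> bool).
Hypothesis tangle_f : tangle n (graphs f).
Hypothesis tangents_f : forall p, U p ->
  tangents D c p = tangle_tangents n (graphs f) rev (c p).
Local Notation col_at := (col_at c col).
Local Notation in_region := (in_region n f).

Lemma in_region_ext (sig sig' : nat -> bool) (x y : R) :
  (forall k, (k < n)%N -> sig k = sig' k) -> in_region sig x y -> in_region sig' x y.
Proof. by move=> ss [y1 H]; split=> // k kn; rewrite -ss //; exact: H. Qed.

Lemma region_uniform (sig : nat -> bool) (P : set R) :
  (forall x y z, P x -> P y -> x <= z <= y -> P z) ->
  (forall x i j, P x -> -1 <= x <= 1 -> (i < n)%N -> (j < n)%N -> sig i -> ~~ sig j ->
     f i x < f j x) ->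
  exists o, forall x y, P x -> -1 <= x <= 1 -> in_region sig x y -> col_at x y = o.
Proof.
move=> Pconv sep.
have [[x0 [y0 [Px0 x01 r0]]]|none] 
  := pselect (exists x y, [/\ P x, -1 <= x <= 1 & in_region sig x y]).
  exists (col_at x0 y0) => x y Px x1 rxy.
  have le x' y' z w : P x' -> P y' -> -1 <= x' <= 1 -> -1 <= y' <= 1 ->
      in_region sig x' z -> in_region sig y' w -> x' <= y' -> col_at x' z = col_at y' w.
    move=> Px' Py' /andP[a1 a2] /andP[b1 b2] rz rw xy'.
    apply: (region_color square colD tangle_f tangents_f (sig := sig)) => //.
    move=> t i j tab; apply: sep; first exact: (Pconv x' y').
    by move: tab => /andP[? ?]; apply/andP; split; lra.
  by case/orP: (le_total x x0) => xx0; [exact: le|apply/esym; exact: le].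
(* The strip is empty over [P], so the color is an arbitrary default. *)
exists (col_at 0 0) => x y Px x1 rxy; case: none.
by exists x, y.
Qed.

Lemma graph_tangent k x : (k < n)%N -> -1 <= x <= 1 ->
  tangents D c (coord_inv c (vec2 x (f k x)))
    (if rev k then vec2 (-1) (- derive1 (f k) x) else vec2 1 (derive1 (f k) x)).
Proof.
move=> kn x1; have [_ fk1 dk] := graphs_derivable tangle_f kn x1.
have q1 : `|vec2 x (f k x)| <= 1.
  by rewrite norm_vec2_le1 x1 /=; move: fk1 => /andP[? ?]; apply/andP; split; lra.
have [Uq _ cq] := square_point square q1.
rewrite (tangents_f Uq) cq; exists k, x, 1; split=> //.
rewrite dk scale1r; apply/rowP => j.
by case: (rev k); rewrite !mxE /=; case: ifP => _; rewrite ?expr0 ?expr1; ring.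
Qed.

Lemma corner_vec2 p (a b a' b' s1 s2 : R) x :
  chart_dom c p -> tangents D c p (vec2 a b) -> tangents D c p (vec2 a' b') ->
  0 < a * b' - b * a' -> s1 != 0 -> s2 != 0 ->
  (\forall r \near (0 : R)^'+,
    col (coord_inv c (c p + r *: vec2 (s1 * a + s2 * a') (s1 * b + s2 * b'))) = x) ->
  corner D col s1 s2 p = x.
Proof.
move=> cp ta tb ab s10 s20 H; apply: (corner_eq colD ac cp ta tb _ s10 s20).
  by rewrite /det2 !vec2_0 !vec2_1.
apply: filterS H => r <-; congr (col (coord_inv c (_ + _ *: _))).
by apply/rowP => j; rewrite !mxE; case: ifP.
Qed.

(** Whatever the orientations, sums and differences of the two tangents are the vectors (0, alpha -
    beta) and (2, alpha + beta) up to sign; orientations only decide which corner each one points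
    to. Coordinates are passed through equations so that their different expressions can be matched
    by linear arithmetic. *)
Lemma corners_turned p (alpha beta : R) (b1 b2 : bool) N W S E :
  chart_dom c p -> beta < alpha ->
  tangents D c p (if b2 then vec2 (-1) (- alpha) else vec2 1 alpha) ->
  tangents D c p (if b1 then vec2 (-1) (- beta) else vec2 1 beta) ->
  let color a b x :=
    \forall r \near (0 : R)^'+, col (coord_inv c (c p + r *: vec2 a b)) = x in
  (forall a b, a = 0 -> b = alpha - beta -> color a b N) ->
  (forall a b, a = - 2 -> b = - (alpha + beta) -> color a b W) ->
  (forall a b, a = 0 -> b = beta - alpha -> color a b S) ->
  (forall a b, a = 2 -> b = alpha + beta -> color a b E) ->
  (corner_left D col p, corner_bottom D col p, corner_right D col p,
   corner_top D col p) = turned b1 b2 N W S E.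
Proof.
move=> cp slope t2 t1 color dN dW dS dE.
have n10 : -1 != 0 :> R by rewrite oppr_eq0 oner_eq0.
have p10 : 1 != 0 :> R by rewrite oner_eq0.
rewrite /corner_left /corner_bottom /corner_right /corner_top.
case: b1 b2 t1 t2 => -[] t1 t2; rewrite /turned.
- congr (_, _, _, _); apply: (corner_vec2 cp t1 t2) => //; try lra;
    [apply: dS|apply: dE|apply: dN|apply: dW]; lra.
- congr (_, _, _, _); apply: (corner_vec2 cp t2 t1) => //; try lra;
    [apply: dW|apply: dS|apply: dE|apply: dN]; lra.
- congr (_, _, _, _); apply: (corner_vec2 cp t2 t1) => //; try lra;
    [apply: dE|apply: dN|apply: dW|apply: dS]; lra.
- congr (_, _, _, _); apply: (corner_vec2 cp t1 t2) => //; try lra;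
    [apply: dN|apply: dW|apply: dS|apply: dE]; lra.
Qed.

(* [i] and [j] cross at x0, [i] having the higher slope; [sig] tells which of
   the other strands pass below the crossing. *)
Lemma graph_corners (sig : nat -> bool) i j (x0 : R) N W S E :
  -1 < x0 < 1 -> (i < n)%N -> (j < n)%N -> f i x0 = f j x0 ->
  derive1 (f j) x0 < derive1 (f i) x0 ->
  (forall k, (k < n)%N -> k != i -> k != j ->
     if sig k then f k x0 < f i x0 else f i x0 < f k x0) ->
  (forall y, in_region (fun k => (k == i) || (k == j) || sig k) x0 y ->
     col_at x0 y = N) ->
  (\forall r \near (0 : R)^'+, forall y,
     in_region (fun k => (k != j) && ((k == i) || sig k)) (x0 - r) y ->
     col_at (x0 - r) y = W) ->
  (forall y, in_region (fun k => (k != i) && (k != j) && sig k) x0 y ->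
     col_at x0 y = S) ->
  (\forall r \near (0 : R)^'+, forall y,
     in_region (fun k => (k != i) && ((k == j) || sig k)) (x0 + r) y ->
     col_at (x0 + r) y = E) ->
  let p := coord_inv c (vec2 x0 (f i x0)) in
  (corner_left D col p, corner_bottom D col p, corner_right D col p,
   corner_top D col p) = turned (rev j) (rev i) N W S E.
Proof.
move=> x01 iN jN fij slope others HN HW HS HE p.
have ne_ij : i != j by apply/eqP => ij; move: slope; rewrite ij ltxx.
have x01' : -1 <= x0 <= 1 by move: x01 => /andP[? ?]; apply/andP; split; lra.
have [di fi1 _] := graphs_derivable tangle_f iN x01'.
have [dj _ _] := graphs_derivable tangle_f jN x01'.
set y0 := f i x0 in fi1 p HN HS *.
have q1 : `|vec2 x0 y0| <= 1.
  by rewrite norm_vec2_le1 x01' /=; move: fi1 => /andP[? ?]; apply/andP; split; lra.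
have [_ cp cpE] := square_point square q1.
rewrite -/p in cp cpE.
set alpha := derive1 (f i) x0 in slope.
set beta := derive1 (f j) x0 in slope.
have pt (a b r : R) : coord_inv c (c p + r *: vec2 a b) =
    coord_inv c (vec2 (x0 + r * a) (y0 + r * b)).
  by rewrite cpE; congr coord_inv; apply/rowP => k; rewrite !mxE; case: ifP.
have R0 : \forall r \near (0 : R)^'+, 0 < r by exact: nbhs_right_gt.
(* Near the crossing every other strand stays on its side of the short vertical segment through it,
   and of the strands [i] and [j]. *)
have near_others : \forall r \near (0 : R)^'+, forall k : 'I_n,
    (k : nat) != i -> (k : nat) != j ->
    (if sig k then f k x0 < y0 - r else y0 + r < f k x0) /\
    (if sig k then f k (x0 + r) < f j (x0 + r) /\ f k (x0 - r) < f i (x0 - r)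
     else f i (x0 + r) < f k (x0 + r) /\ f j (x0 - r) < f k (x0 - r)).
  apply: filter_forall => k; have [ki|ki] := eqVneq (k : nat) i.
    by apply: nearW => r.
  have [kj|kj] := eqVneq (k : nat) j.
    by apply: nearW => r.
  have := others k (ltn_ord k) ki kj.
  have [dk _ _] := graphs_derivable tangle_f (ltn_ord k) x01'.
  case: (sig k) => lt.
    have R1 : \forall r \near (0 : R)^'+, r < y0 - f k x0.
      by apply: nbhs_right_lt; rewrite subr_gt0.
    have ltj : f k x0 < f j x0 by rewrite -fij.
    apply: filterS3 R1 (lt_near dk di lt) (lt_near dk dj ltj) => r r1 [? ?] [? ?] _ _.
    by split=> //; lra.
  have R1 : \forall r \near (0 : R)^'+, r < f k x0 - y0.
    by apply: nbhs_right_lt; rewrite subr_gt0.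
  have ltj : f j x0 < f k x0 by rewrite -fij.
  apply: filterS3 R1 (lt_near di dk lt) (lt_near dj dk ltj) => r r1 [? ?] [? ?] _ _.
  by split=> //; lra.
have Rx : \forall r \near (0 : R)^'+, -1 <= x0 - r /\ x0 + r <= 1.
  move: x01 => /andP[x0m x0p].
  have R1 : \forall r \near (0 : R)^'+, r < x0 + 1 by apply: nbhs_right_lt; lra.
  have R2 : \forall r \near (0 : R)^'+, r < 1 - x0 by apply: nbhs_right_lt; lra.
  by apply: filterS2 R1 R2 => r ? ?; split; lra.
have Ry : \forall r \near (0 : R)^'+, -1 <= y0 - r /\ y0 + r <= 1.
  move: fi1 => /andP[y0m y0p].
  have R1 : \forall r \near (0 : R)^'+, r < y0 + 1 by apply: nbhs_right_lt; lra.
  have R2 : \forall r \near (0 : R)^'+, r < 1 - y0 by apply: nbhs_right_lt; lra.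
  by apply: filterS2 R1 R2 => r ? ?; split; lra.
have dN (a b : R) : a = 0 -> b = alpha - beta ->
    \forall r \near (0 : R)^'+, col (coord_inv c (c p + r *: vec2 a b)) = N.
  move=> -> bE; have b0 : 0 < b by rewrite bE; lra.
  have : \forall r \near (0 : R)^'+, col_at x0 (y0 + r) = N.
    apply: filterS3 R0 near_others Ry => r r0 oth [ym yp]; apply: HN.
    split=> [|k kn]; first by apply/andP; split; lra.
    have [->|ki] := eqVneq k i; first by rewrite /= -/y0; lra.
    have [->|kj] := eqVneq k j; first by rewrite /= -fij -/y0; lra.
    by have [+ _] := oth (Ordinal kn) ki kj; rewrite /=; case: (sig k) => //; lra.
  move=> /(near_right_scale b0); apply: filterS => r <-.
  by rewrite pt mulr0 addr0.
have dS (a b : R) : a = 0 -> b = beta - alpha ->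
    \forall r \near (0 : R)^'+, col (coord_inv c (c p + r *: vec2 a b)) = S.
  move=> -> bE; have b0 : 0 < - b by rewrite bE; lra.
  have : \forall r \near (0 : R)^'+, col_at x0 (y0 - r) = S.
    apply: filterS3 R0 near_others Ry => r r0 oth [ym yp]; apply: HS.
    split=> [|k kn]; first by apply/andP; split; lra.
    have [->|ki] := eqVneq k i; first by rewrite /= -/y0; lra.
    have [->|kj] := eqVneq k j; first by rewrite /= -fij -/y0; lra.
    by have [+ _] := oth (Ordinal kn) ki kj; rewrite /=; case: (sig k) => //; lra.
  move=> /(near_right_scale b0); apply: filterS => r <-.
  by rewrite pt mulr0 addr0 mulrN opprK.
(* The line of mean slope through the crossing runs between the two strands on both sides; its
   direction (1, m) is half of (2, alpha + beta), whence the rescaling by 2 below. *)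
pose m := 2^-1 * (alpha + beta).
have ma : m < alpha by rewrite /m; lra.
have bm : beta < m by rewrite /m; lra.
have two0 : 0 < 2 :> R by lra.
have in_square k r : (k < n)%N -> 0 < r -> -1 <= x0 - r /\ x0 + r <= 1 ->
    -1 < f k (x0 + r) < 1 /\ -1 < f k (x0 - r) < 1.
  move=> kn r0 [? ?].
  have [|_ ? _] := graphs_derivable tangle_f kn (x := x0 + r).
    by apply/andP; split; lra.
  have [|_ ? _] := graphs_derivable tangle_f kn (x := x0 - r).
    by apply/andP; split; lra.
  by [].
have dE (a b : R) : a = 2 -> b = alpha + beta ->
    \forall r \near (0 : R)^'+, col (coord_inv c (c p + r *: vec2 a b)) = E.
  move=> -> bE.
  have slj := slope_lt dj bm.
  have sli := slope_gt di ma.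
  have : \forall r \near (0 : R)^'+, col_at (x0 + r) (y0 + m * r) = E.
    near=> r.
    have r0 : 0 < r by near: r.
    have xr : -1 <= x0 - r /\ x0 + r <= 1 by near: r.
    have [sj _] : f j (x0 + r) < f j x0 + m * r /\ f j x0 - m * r < f j (x0 - r)
      by near: r.
    have [si _] : f i x0 + m * r < f i (x0 + r) /\ f i (x0 - r) < f i x0 - m * r
      by near: r.
    have oth := near near_others r.
    apply: (near HE r) => //.
    have [/andP[fim fip] _] := in_square i r iN r0 xr.
    have [/andP[fjm fjp] _] := in_square j r jN r0 xr.
    rewrite -fij -/y0 in sj; rewrite -/y0 in si.
    split=> [|k kn].
      by apply/andP; split; apply: ltW; [exact: lt_trans fjm sj|exact: lt_trans si fip].
    have [->|ki] := eqVneq k i; first by rewrite /=.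
    have [->|kj] := eqVneq k j; first by rewrite /=.
    have [//|_] := oth _ (Ordinal kn) ki kj.
    by rewrite /=; case: (sig k) => -[lt _]; [exact: lt_trans lt sj|exact: lt_trans si lt].
  move=> /(near_right_scale two0); apply: filterS => r <-.
  by rewrite pt bE /m; congr (col (coord_inv c (vec2 _ _))); field.
have dW (a b : R) : a = - 2 -> b = - (alpha + beta) ->
    \forall r \near (0 : R)^'+, col (coord_inv c (c p + r *: vec2 a b)) = W.
  move=> -> bE.
  have slj := slope_lt dj bm.
  have sli := slope_gt di ma.
  have : \forall r \near (0 : R)^'+, col_at (x0 - r) (y0 - m * r) = W.
    near=> r.
    have r0 : 0 < r by near: r.
    have xr : -1 <= x0 - r /\ x0 + r <= 1 by near: r.
    have [_ sj] : f j (x0 + r) < f j x0 + m * r /\ f j x0 - m * r < f j (x0 - r)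
      by near: r.
    have [_ si] : f i x0 + m * r < f i (x0 + r) /\ f i (x0 - r) < f i x0 - m * r
      by near: r.
    have oth := near near_others r.
    apply: (near HW r) => //.
    have [_ /andP[fim fip]] := in_square i r iN r0 xr.
    have [_ /andP[fjm fjp]] := in_square j r jN r0 xr.
    rewrite -fij -/y0 in sj; rewrite -/y0 in si.
    split=> [|k kn].
      by apply/andP; split; apply: ltW; [exact: lt_trans fim si|exact: lt_trans sj fjp].
    have [->|kj] := eqVneq k j; first by rewrite /=.
    have [->|ki] := eqVneq k i; first by rewrite /=.
    have [//|_] := oth _ (Ordinal kn) ki kj.
    by rewrite /=; case: (sig k) => -[_ lt]; [exact: lt_trans lt si|exact: lt_trans sj lt].
  move=> /(near_right_scale two0); apply: filterS => r <-.
  by rewrite pt bE /m; congr (col (coord_inv c (vec2 _ _))); field.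
have ti := graph_tangent iN x01'; rewrite -/y0 -/p -/alpha in ti.
have tj := graph_tangent jN x01'; rewrite -fij -/y0 -/p -/beta in tj.
exact: (corners_turned cp slope ti tj dN dW dS dE).
Unshelve. all: by end_near.
Qed.

End GraphCrossing.

(** * Contributions of the crossings inside and outside the disk *)

Section Sums.
Variables (R : realType) (F : oriented_surface R).
Local Notation plane := 'rV[R]_2.
Variables (X : choiceType) (T : X -> X -> X -> X).

Definition local_chain (D : diagram F) (col : F -> X) (p : F) : chain X 1 :=
  triple (corner_left D col p) (corner_bottom D col p) (corner_right D col p).

Lemma corners_chain (D : diagram F) (col : F -> X) p b1 b2 N W S E :
  coloring D T col -> crossings D p ->
  (corner_left D col p, corner_bottom D col p, corner_right D col p,
   corner_top D col p) = turned b1 b2 N W S E ->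
  local_chain D col p = crossing_chain b1 b2 N W S E /\
  crossing_rule T b1 b2 N W S E.
Proof.
by move=> [_ rule] Dp E'; rewrite /crossing_chain /crossing_rule -E'; split; [|exact: rule].
Qed.

Lemma diagram_chain_local (D D' : diagram F) (col col' : F -> X) (U : set F) :
  (forall p, ~ U p -> crossings D p <-> crossings D' p) ->
  (forall p, ~ U p -> crossings D p -> local_chain D col p = local_chain D' col' p) ->
  diagram_chain D col - diagram_chain D' col' =
  \sum_(p \in crossings D `&` U) local_chain D col p -
  \sum_(p \in crossings D' `&` U) local_chain D' col' p.
Proof.
move=> crD colD.
have split_sum (E : diagram F) (cE : F -> X) : diagram_chain E cE =
    \sum_(p \in crossings E `&` U) local_chain E cE p +
    \sum_(p \in crossings E `&` ~` U) local_chain E cE p.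
  by rewrite -(fsbigID U) //; exact: multiple_points_finite.
have same : crossings D `&` ~` U = crossings D' `&` ~` U.
  by apply/seteqP; split=> p [Dp Up]; split=> //; apply/(crD _ Up).
rewrite !split_sum same opprD addrACA.
have -> : \sum_(p \in crossings D' `&` ~` U) local_chain D col p =
    \sum_(p \in crossings D' `&` ~` U) local_chain D' col' p.
  by apply: eq_fsbigr => p; rewrite -same inE => -[Dp Up]; exact: colD.
by rewrite subrr addr0.
Qed.

Lemma fsbig_set2 (f : F -> chain X 1) (a b : F) : a <> b ->
  \sum_(p \in [set a; b]) f p = f a + f b.
Proof.
move=> ab; rewrite fsbigU0 ?fsbig_set1 //.
by move=> p [/= -> /=]; exact: ab.
Qed.

Lemma fsbig_set3 (f : F -> chain X 1) (a b d : F) : a <> b -> a <> d -> b <> d ->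
  \sum_(p \in [set a; b; d]) f p = f a + f b + f d.
Proof.
move=> ab ad bd; rewrite fsbigU0 ?fsbig_set1 ?fsbig_set2 //.
by move=> p [[/=|/=] -> /=]; [exact: ad|exact: bd].
Qed.

End Sums.

(** * Colors of strips and their comparison before and after a move *)

Section Uniform.
Variables (R : realType) (F : oriented_surface R).
Local Notation plane := 'rV[R]_2.
Local Notation domain_interior c := (interior (c @` chart_dom c)).
Variables (X : choiceType) (T : X -> X -> X -> X).
Variable c : chart R F.
Hypothesis ac : atlas F c.
Hypothesis square : [set v : plane | `|v| <= 1] `<=` domain_interior c.
Local Notation U := [set p | chart_dom c p /\ `|c p| <= 1].
Variable n : nat.
Variable rev : nat -> bool.

(* The bounds -2 and 2 stand for the absence of a bound on x. *)
Definition uniform (f : nat -> R -> R) (col : F -> X) (sig : nat -> bool)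
    (a b : R) (o : X) : Prop :=
  forall x y, a < x < b -> -1 <= x <= 1 -> in_region n f sig x y ->
    col_at c col x y = o.

Lemma square_point_inj (x y x' y' : R) :
  -1 <= x <= 1 -> -1 <= y <= 1 -> -1 <= x' <= 1 -> -1 <= y' <= 1 ->
  coord_inv c (vec2 x y) = coord_inv c (vec2 x' y') -> x = x'.
Proof.
move=> x1 y1 x1' y1' E.
have q : `|vec2 x y| <= 1 by rewrite norm_vec2_le1 x1 y1.
have q' : `|vec2 x' y'| <= 1 by rewrite norm_vec2_le1 x1' y1'.
have [_ _ e] := square_point square q; have [_ _ e'] := square_point square q'.
by have := congr1 (fun v : plane => v 0 0) e; rewrite E e' !vec2_0.
Qed.

Section OneDiagram.
Variables (D : diagram F) (col : F -> X).
Hypothesis colD : coloring D T col.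
Variable f : nat -> R -> R.
Hypothesis tangle_f : tangle n (graphs f).
Hypothesis tangents_f : forall p, U p ->
  tangents D c p = tangle_tangents n (graphs f) rev (c p).
Local Notation uniform := (uniform f col).

Lemma uniform_exists (sig : nat -> bool) (a b : R) :
  (forall x i j, a < x < b -> -1 <= x <= 1 -> (i < n)%N -> (j < n)%N ->
     sig i -> ~~ sig j -> f i x < f j x) ->
  exists o, uniform sig a b o.
Proof.
move=> sep.
apply: (region_uniform square colD tangle_f tangents_f (P := [set x | a < x < b])) => //.
by move=> x y z /= /andP[? ?] /andP[? ?] /andP[? ?]; apply/andP; split; lra.
Qed.

Lemma uniform_ext (sig sig' : nat -> bool) (a b : R) o :
  (forall k, (k < n)%N -> sig k = sig' k) ->
  uniform sig a b o -> uniform sig' a b o.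
Proof.
move=> ss u x y xab x1 r; apply: u => //.
by apply: in_region_ext r => k kn; rewrite ss.
Qed.

Lemma in_region_exists (sig : nat -> bool) (x : R) : -1 <= x <= 1 ->
  (forall i j, (i < n)%N -> (j < n)%N -> sig i -> ~~ sig j -> f i x < f j x) ->
  exists y, in_region n f sig x y.
Proof.
move=> x1 sep.
pose lo := \big[Num.max/-1]_(k < n | sig k) f k x.
pose up := \big[Num.min/1]_(k < n | ~~ sig k) f k x.
have lu : lo < up.
  apply/bigmin_gtP; split=> [|j sj].
    apply/bigmax_ltP; split=> [|i si]; first lra.
    by have [_ /andP[]] := graphs_derivable tangle_f (ltn_ord i) x1.
  apply/bigmax_ltP; split=> [|i si]; last exact: sep.
  by have [_ /andP[]] := graphs_derivable tangle_f (ltn_ord j) x1.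
have lo1 : -1 <= lo by exact: bigmax_ge_id.
have up1 : up <= 1 by exact: bigmin_le_id.
exists (2^-1 * (lo + up)); split=> [|k kn]; first by apply/andP; split; lra.
case: ifP => sk.
  have : f k x <= lo by exact: (@le_bigmax_cond _ _ _ _ (Ordinal kn)
    (fun k : 'I_n => sig k) (fun k : 'I_n => f k x)).
  lra.
have : up <= f k x by apply: (@bigmin_le_cond _ _ _ _ (Ordinal kn)
  (fun k : 'I_n => ~~ sig k) (fun k : 'I_n => f k x)); rewrite /= sk.
lra.
Qed.

(** Each strip keeps its own label and range, so that one strip can serve at several crossings. The
    west and east strips may end at [x0], since they are read at [x0 - r] and [x0 + r]; the north
    and south strips are read on the vertical line through the crossing and must extend past it. *)
Lemma graph_crossing (sig sN sW sS sE : nat -> bool) i j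
    (x0 aN bN aW bW aS bS aE bE : R) N W S E p :
  -1 < x0 < 1 -> (i < n)%N -> (j < n)%N -> f i x0 = f j x0 ->
  derive1 (f j) x0 < derive1 (f i) x0 ->
  (forall k, (k < n)%N -> k != i -> k != j ->
     if sig k then f k x0 < f i x0 else f i x0 < f k x0) ->
  uniform sN aN bN N ->
  (forall k, (k < n)%N -> sN k = (k == i) || (k == j) || sig k) ->
  aN < x0 < bN ->
  uniform sW aW bW W ->
  (forall k, (k < n)%N -> sW k = (k != j) && ((k == i) || sig k)) ->
  aW < x0 <= bW ->
  uniform sS aS bS S ->
  (forall k, (k < n)%N -> sS k = (k != i) && (k != j) && sig k) ->
  aS < x0 < bS ->
  uniform sE aE bE E ->
  (forall k, (k < n)%N -> sE k = (k != i) && ((k == j) || sig k)) ->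
  aE <= x0 < bE ->
  p = coord_inv c (vec2 x0 (f i x0)) ->
  [/\ crossings D p, U p, local_chain D col p = crossing_chain (rev j) (rev i) N W S E &
      crossing_rule T (rev j) (rev i) N W S E].
Proof.
move=> x01 iN jN fij slope others uN eN xN uW eW /andP[aW0 bW0] uS eS xS uE eE
  /andP[aE0 bE0] pE.
have {}uN := uniform_ext eN uN; have {}uW := uniform_ext eW uW.
have {}uS := uniform_ext eS uS; have {}uE := uniform_ext eE uE.
have x01' : -1 <= x0 <= 1 by move: x01 => /andP[? ?]; apply/andP; split; lra.
have [_ fi1 _] := graphs_derivable tangle_f iN x01'.
have q1 : `|vec2 x0 (f i x0)| <= 1.
  by rewrite norm_vec2_le1 x01' /=; move: fi1 => /andP[? ?]; apply/andP; split; lra.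
have [Up _ cpE] := square_point square q1; rewrite -pE in Up cpE.
have Dp : crossings D p.
  apply/(graphs_crossing ac tangle_f tangents_f Up); exists j, i.
  by rewrite cpE vec2_0; split; rewrite ?fij.
suff turnE : (corner_left D col p, corner_bottom D col p, corner_right D col p,
    corner_top D col p) = turned (rev j) (rev i) N W S E.
  by have [? ?] := corners_chain colD Dp turnE.
move/andP: x01 => [x0m x0p]; rewrite pE.
apply: (graph_corners ac square colD tangle_f tangents_f (sig := sig)) => //.
- by rewrite x0m x0p.
- by move=> y; exact: uN.
- apply/near_right; exists (Num.min (x0 - aW) (x0 + 1)).
    by rewrite lt_min; apply/andP; split; lra.
  move=> r; rewrite lt_min => /andP[r0 /andP[r1 r2]] y; apply: uW.
    by apply/andP; split; lra.
  by apply/andP; split; lra.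
- by move=> y; exact: uS.
- apply/near_right; exists (Num.min (bE - x0) (1 - x0)).
    by rewrite lt_min; apply/andP; split; lra.
  move=> r; rewrite lt_min => /andP[r0 /andP[r1 r2]] y; apply: uE.
    by apply/andP; split; lra.
  by apply/andP; split; lra.
Qed.

Lemma crossings_in_disk p : (crossings D `&` U) p -> exists x i j,
  [/\ [/\ -1 <= x <= 1, (i < n)%N & (j < n)%N], f i x = f j x,
    derive1 (f i) x < derive1 (f j) x, p = coord_inv c (vec2 x (f i x)) &
    p = coord_inv c (vec2 x (f j x))].
Proof.
move=> [Dp Up]; have [i [j [iN jN Ei Ej ij]]] := (graphs_crossing ac tangle_f tangents_f Up).1 Dp.
have [cp p1] := Up.
exists (c p 0 0), i, j; split=> //; last 2 first.
- by rewrite -Ei coordK.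
- by rewrite -Ej coordK.
- split=> //.
  by move: p1; rewrite norm_plane_le // => /andP[]; rewrite ler_norml.
- by have := congr1 (fun v : plane => v 0 1) Ei; rewrite {1}Ej !vec2_1.
Qed.

End OneDiagram.

(** At a vertical side of the square the strands of both pictures have the same ends, so a point of
    the strip there lies on the boundary of the disk and off both diagrams: [boundary_color]
    applies. *)
Lemma uniform_match (D D' : diagram F) (col col' : F -> X) (f g : nat -> R -> R)
    (sig : nat -> bool) (a b a' b' : R) o o' (x : R) :
  coloring D T col -> coloring D' T col' -> agree_off D D' col col' U ->
  tangle n (graphs f) ->
  (forall p, U p -> tangents D c p = tangle_tangents n (graphs f) rev (c p)) ->
  (forall p, U p -> tangents D' c p = tangle_tangents n (graphs g) rev (c p)) ->
  x = -1 \/ x = 1 -> (forall k, (k < n)%N -> f k x = g k x) ->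
  a < x < b -> a' < x < b' ->
  (forall i j, (i < n)%N -> (j < n)%N -> sig i -> ~~ sig j -> f i x < f j x) ->
  uniform f col sig a b o -> uniform g col' sig a' b' o' -> o = o'.
Proof.
move=> colD colD' agree tf tD tD' x1 fg xab xab' sep u u'.
have x11 : -1 <= x <= 1 by apply/andP; case: x1 => ->; split; lra.
have [y ry] := in_region_exists tf x11 sep.
have ry' : in_region n g sig x y.
  by case: ry => y1 H; split=> // k kn; rewrite -fg //; exact: H.
rewrite -(u x y xab x11 ry) -(u' x y xab' x11 ry').
have [y1 _] := ry.
have q1 : `|vec2 x y| <= 1 by rewrite norm_vec2_le1 x11 y1.
have off (E : diagram F) h : (forall p, U p ->
      tangents E c p = tangle_tangents n (graphs h) rev (c p)) ->
    in_region n h sig x y -> ~ underlying E (coord_inv c (vec2 x y)).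
  move=> tE [_ H] /(underlying_tangle square tE q1)[k [t [kn _ E']]].
  have Et : t = x by have := congr1 (fun v : plane => v 0 0) E'; rewrite !vec2_0.
  have := congr1 (fun v : plane => v 0 1) E'; rewrite !vec2_1 Et => Ey.
  by have := H k kn; rewrite Ey; case: ifP; rewrite ltxx.
apply: (boundary_color square colD colD' agree); [|exact: off tD ry|exact: off tD' ry'].
apply/eqP; rewrite eq_le q1 /=.
have := lexx `|vec2 x y|; rewrite norm_plane_le // vec2_0 => /andP[+ _].
by case: x1 => ->; rewrite ?normrN normr1.
Qed.

End Uniform.

(** * The second move *)

Section CrossOnce.
Variable R : realType.

Lemma cross_once_eq (f g : R -> R) x0 x :
  cross_once_at f g x0 -> -1 <= x <= 1 -> f x = g x -> x = x0.
Proof.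
move=> [_ lt _ _ gt] /andP[xm xp] fg; have [xx0|x0x|//] := ltgtP x x0.
  by have := lt x; rewrite xm xx0 fg ltxx => /(_ isT).
by have := gt x; rewrite xp x0x fg ltxx => /(_ isT).
Qed.

Lemma cross_once_lt (f g : R -> R) x0 x :
  cross_once_at f g x0 -> -1 <= x -> x < x0 -> f x < g x.
Proof. by move=> [_ lt _ _ _] xm xx0; apply: lt; rewrite xm. Qed.

Lemma cross_once_gt (f g : R -> R) x0 x :
  cross_once_at f g x0 -> x <= 1 -> x0 < x -> g x < f x.
Proof. by move=> [_ _ _ _ gt] xp x0x; apply: gt; rewrite xp x0x. Qed.

Lemma cross_once_slope (f g : R -> R) x0 :
  cross_once_at f g x0 -> derivable f x0 1 -> derivable g x0 1 ->
  derive1 g x0 < derive1 f x0.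
Proof.
move=> [/andP[_ x01] _ fg ne gt] df dg; apply: slope_order => //.
apply/near_right; exists (1 - x0); first lra.
by move=> r /andP[r0 r1]; apply/ltW/gt; apply/andP; split; lra.
Qed.

Definition among (l : seq nat) (k : nat) : bool := k \in l.

Lemma forall_lt2 (s s' : nat -> bool) : s 0%N = s' 0%N -> s 1%N = s' 1%N ->
  forall k, (k < 2)%N -> s k = s' k.
Proof. by move=> e0 e1 [|[|]]. Qed.

Lemma forall_lt3 (s s' : nat -> bool) : s 0%N = s' 0%N -> s 1%N = s' 1%N ->
  s 2%N = s' 2%N -> forall k, (k < 3)%N -> s k = s' k.
Proof. by move=> e0 e1 e2 [|[|[|]]]. Qed.

End CrossOnce.

Section Bigon.
Variables (R : realType) (F : oriented_surface R).
Local Notation plane := 'rV[R]_2.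
Local Notation domain_interior c := (interior (c @` chart_dom c)).
Variables (X : choiceType) (T : X -> X -> X -> X).
Variable c : chart R F.
Hypothesis ac : atlas F c.
Hypothesis square : [set v : plane | `|v| <= 1] `<=` domain_interior c.
Local Notation U := [set p | chart_dom c p /\ `|c p| <= 1].
Variable rev : nat -> bool.
Variables (D D' : diagram F) (col col' : F -> X).
Hypotheses (colD : coloring D T col) (colD' : coloring D' T col').
Hypothesis agree : agree_off D D' col col' U.
Variables f g : nat -> R -> R.
Hypotheses (tf : tangle 2 (graphs f)) (tg : tangle 2 (graphs g)).
Hypothesis tD : forall p, U p ->
  tangents D c p = tangle_tangents 2 (graphs f) rev (c p).
Hypothesis tD' : forall p, U p ->
  tangents D' c p = tangle_tangents 2 (graphs g) rev (c p).
Hypothesis ends : forall k, (k < 2)%N -> f k (-1) = g k (-1) /\ f k 1 = g k 1.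

Lemma move2_before : (forall x, -1 <= x <= 1 -> f 0%N x < f 1%N x) ->
  crossings D `&` U = set0.
Proof.
move=> f01; apply/seteqP; split=> // p.
move/(crossings_in_disk ac tf tD) => [x [i [j [[x1 iN jN] fij dij _ _]]]].
have := f01 x x1; move: i j iN jN fij dij => [|[|//]] [|[|//]] _ _ E;
  by rewrite ?ltxx // E ltxx.
Qed.

Lemma move2_chain a b : -1 < a -> a < b -> b < 1 ->
  (forall x, -1 <= x <= 1 -> f 0%N x < f 1%N x) ->
  (forall x, -1 <= x < a \/ b < x <= 1 -> g 0%N x < g 1%N x) ->
  (forall x, a < x < b -> g 1%N x < g 0%N x) ->
  g 0%N a = g 1%N a /\ derive1 (g 0%N) a <> derive1 (g 1%N) a ->
  g 0%N b = g 1%N b /\ derive1 (g 0%N) b <> derive1 (g 1%N) b ->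
  chainI T (n := 1) (\sum_(p \in crossings D' `&` U) local_chain D' col' p).
Proof.
move=> am ab bp f01 gout gin [ga dga] [gb dgb].
have [a1 b1] : -1 <= a <= 1 /\ -1 <= b <= 1 by split; apply/andP; split; lra.
have a1' : a < 1 := lt_trans ab bp; have b1' : -1 < b := lt_trans am ab.
have [n21 p12] : (-2 : R) < -1 /\ (1 : R) < 2 by split; lra.
have a2 : -2 < a := lt_trans n21 am; have b2 : b < 2 := lt_trans bp p12.
have a2' : a < 2 := lt_trans a1' p12; have b2' : -2 < b := lt_trans n21 b1'.
have m2 : (-2 : R) < 1 := lt_trans n21 (lt_trans am a1').
have m2' : (-1 : R) < 2 := lt_trans (lt_trans am a1') p12.
have m1 : (-1 : R) <= 1 := ltW (lt_trans am a1').
have [dg0a g0a _] := graphs_derivable tg (isT : (0 < 2)%N) a1.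
have [dg1a _ _] := graphs_derivable tg (isT : (1 < 2)%N) a1.
have [dg0b g0b _] := graphs_derivable tg (isT : (0 < 2)%N) b1.
have [dg1b _ _] := graphs_derivable tg (isT : (1 < 2)%N) b1.
(* Strand 0 rises above strand 1 at [a] and returns below it at [b], so the roles of higher and
   lower slope are exchanged. *)
have sa : derive1 (g 1%N) a < derive1 (g 0%N) a.
  apply: slope_order => //; apply/near_right; exists (b - a); first lra.
  by move=> r /andP[r0 r1]; apply/ltW/gin; apply/andP; split; lra.
have sb : derive1 (g 0%N) b < derive1 (g 1%N) b.
  apply: slope_order => //; first exact: nesym.
  apply/near_right; exists (1 - b); first lra.
  by move=> r /andP[r0 r1]; apply/ltW/gout; right; apply/andP; split; lra.
(* In the picture after the move [W] and [E] are separated by the inner region [M]. They are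
   identified through [V], the strip between the strands before the move, which touches both
   vertical sides. *)
have [V uV] : exists V, uniform c 2 f col (among [:: 0%N]) (-2) 2 V.
  apply: (uniform_exists square colD tf tD) => x i j _ x1.
  by move: i j => [|[|//]] [|[|//]] //= _ _ _ _; exact: f01.
have [N uN] : exists N, uniform c 2 g col' (among [:: 0; 1]%N) (-2) 2 N.
  apply: (uniform_exists square colD' tg tD') => x i j _ x1.
  by move: i j => [|[|//]] [|[|//]].
have [S uS] : exists S, uniform c 2 g col' (among [::]) (-2) 2 S.
  by apply: (uniform_exists square colD' tg tD').
have [W uW] : exists W, uniform c 2 g col' (among [:: 0%N]) (-2) a W.
  apply: (uniform_exists square colD' tg tD') => x i j /andP[_ xa] /andP[xm _].
  by move: i j => [|[|//]] [|[|//]] //= _ _ _ _; apply: gout; left; rewrite xm.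
have [M uM] : exists M, uniform c 2 g col' (among [:: 1%N]) a b M.
  apply: (uniform_exists square colD' tg tD') => x i j xab _.
  by move: i j => [|[|//]] [|[|//]] //= _ _ _ _; exact: gin.
have [E uE] : exists E, uniform c 2 g col' (among [:: 0%N]) b 2 E.
  apply: (uniform_exists square colD' tg tD') => x i j /andP[bx _] /andP[_ xp].
  by move: i j => [|[|//]] [|[|//]] //= _ _ _ _; apply: gout; right; rewrite bx.
have sep x : -1 <= x <= 1 -> forall i j, (i < 2)%N -> (j < 2)%N ->
    among [:: 0%N] i -> ~~ among [:: 0%N] j -> f i x < f j x.
  by move=> x1 [|[|//]] [|[|//]] //= _ _ _ _; exact: f01.
have VW : V = W.
  apply: (uniform_match square colD colD' agree tf tD tD' (x := -1) _ _ _ _ _ uV uW).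
  - by left.
  - by move=> k /ends[].
  - by apply/andP.
  - by apply/andP.
  - by apply: sep; apply/andP.
have VE : V = E.
  apply: (uniform_match square colD colD' agree tf tD tD' (x := 1) _ _ _ _ _ uV uE).
  - by right.
  - by move=> k /ends[].
  - by apply/andP.
  - by apply/andP.
  - by apply: sep; apply/andP.
pose pa := coord_inv c (vec2 a (g 0%N a)).
pose pb := coord_inv c (vec2 b (g 1%N b)).
have [Da Ua Ea ra] : [/\ crossings D' pa, U pa,
    local_chain D' col' pa = crossing_chain (rev 1%N) (rev 0%N) N W S M &
    crossing_rule T (rev 1%N) (rev 0%N) N W S M].
  have H := graph_crossing ac square colD' tg tD' (sig := fun=> false) (i := 0%N) (j := 1%N)
    (x0 := a) _ isT isT ga sa _ uN _ _
    uW _ _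
    uS _ _
    uM _ _ erefl.
  by apply: H; [by apply/andP|case=> [|[|]]|apply: forall_lt2
    |by apply/andP|apply: forall_lt2|by apply/andP
    |apply: forall_lt2|by apply/andP|apply: forall_lt2
    |by apply/andP].
have [Db Ub Eb rb] : [/\ crossings D' pb, U pb,
    local_chain D' col' pb = crossing_chain (rev 0%N) (rev 1%N) N M S E &
    crossing_rule T (rev 0%N) (rev 1%N) N M S E].
  have H := graph_crossing ac square colD' tg tD' (sig := fun=> false) (i := 1%N) (j := 0%N)
    (x0 := b) _ isT isT (esym gb) sb _ uN _ _ uM _ _ uS _ _ uE _ _ erefl.
  by apply: H; [by apply/andP|case=> [|[|]]|apply: forall_lt2
    |by apply/andP|apply: forall_lt2|by apply/andP
    |apply: forall_lt2|by apply/andP|apply: forall_lt2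
    |by apply/andP].
have -> : crossings D' `&` U = [set pa; pb].
  apply/seteqP; split=> [p|p [|] ->//].
  move/(crossings_in_disk ac tg tD') => [x [i [j [[/andP[xm xp] iN jN] gij dij Ei Ej]]]].
  have eq01 : g 0%N x = g 1%N x.
    by move: i j iN jN gij dij {Ei Ej} => [|[|//]] [|[|//]] _ _ E'; rewrite ?ltxx.
  have p0 : p = coord_inv c (vec2 x (g 0%N x)).
    by move: i iN Ei {gij dij} => [|[|//]] _ ->; rewrite ?eq01.
  have [xa|ax|xa] := ltgtP x a.
  - have := gout x; rewrite eq01 ltxx => H; exfalso.
    by suff: false by []; apply: H; left; rewrite xm.
  - have [xb|bx|xb] := ltgtP x b.
    + by have := gin x; rewrite eq01 ltxx ax xb => /(_ isT).
    + have := gout x; rewrite eq01 ltxx => H; exfalso.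
      by suff: false by []; apply: H; right; rewrite bx.
    + by right; rewrite p0 /pb xb gb.
  - by left; rewrite p0 /pa xa.
have pab : pa <> pb.
  move/(square_point_inj square a1 _ b1 _) => H.
  have weak (y : R) : -1 < y < 1 -> -1 <= y <= 1 by move=> /andP[/ltW -> /ltW ->].
  have /eqP : a = b by apply: H; apply: weak => //; rewrite -gb.
  by rewrite lt_eqF.
rewrite fsbig_set2 // Ea Eb -VE VW; exact: bigon_chain ra.
Qed.

End Bigon.

(** * The third move *)

Section Triangle.
Variables (R : realType) (F : oriented_surface R).
Local Notation plane := 'rV[R]_2.
Local Notation domain_interior c := (interior (c @` chart_dom c)).
Variables (X : choiceType) (T : X -> X -> X -> X).
Variable c : chart R F.
Hypothesis ac : atlas F c.
Hypothesis square : [set v : plane | `|v| <= 1] `<=` domain_interior c.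
Local Notation U := [set p | chart_dom c p /\ `|c p| <= 1].
Variable rev : nat -> bool.

(* The colors of the regions touching the boundary of the square, in
   counterclockwise order from the top one, when three strands reverse their
   vertical order. *)
Definition hexagon (f : nat -> R -> R) (col : F -> X) (l1 l2 r1 r2 : R)
    (h0 h1 h2 h3 h4 h5 : X) : Prop :=
  let region := uniform c 3 f col in
  [/\ region (among [:: 0; 1; 2]%N) (-2) 2 h0, region (among [:: 0; 1]%N) (-2) l1 h1,
      region (among [:: 0]%N) (-2) l2 h2, region (among [::]) (-2) 2 h3 &
      region (among [:: 2]%N) r1 2 h4 /\ region (among [:: 1; 2]%N) r2 2 h5].

Section OneDiagram.
Variables (D : diagram F) (col : F -> X).
Hypothesis colD : coloring D T col.
Variable f : nat -> R -> R.
Hypothesis tf : tangle 3 (graphs f).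
Hypothesis tD : forall p, U p ->
  tangents D c p = tangle_tangents 3 (graphs f) rev (c p).
Variables x01 x02 x12 : R.
Hypotheses (C01 : cross_once_at (f 0%N) (f 1%N) x01)
  (C02 : cross_once_at (f 0%N) (f 2%N) x02) (C12 : cross_once_at (f 1%N) (f 2%N) x12).
Let p01 := coord_inv c (vec2 x01 (f 0%N x01)).
Let p02 := coord_inv c (vec2 x02 (f 0%N x02)).
Let p12 := coord_inv c (vec2 x12 (f 1%N x12)).
Local Notation local := (local_chain D col).
Local Notation uniform := (uniform c 3 f col).

Lemma cross_slope i j x0 : cross_once_at (f i) (f j) x0 -> (i < 3)%N -> (j < 3)%N ->
  derive1 (f j) x0 < derive1 (f i) x0.
Proof.
move=> C iN jN; have [/andP[/ltW xm /ltW xp] _ _ _ _] := C.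
have x01' : -1 <= x0 <= 1 by apply/andP.
have [di _ _] := graphs_derivable tf iN x01'; have [dj _ _] := graphs_derivable tf jN x01'.
exact: cross_once_slope.
Qed.

Lemma triangle_sum : crossings D p01 -> crossings D p02 -> crossings D p12 ->
  U p01 -> U p02 -> U p12 -> x01 != x02 -> x02 != x12 -> x01 != x12 ->
  \sum_(p \in crossings D `&` U) local p = local p01 + local p02 + local p12.
Proof.
move=> D01 D02 D12 U01 U02 U12 ne1 ne2 ne3.
have weak (y : R) : -1 < y < 1 -> -1 <= y <= 1 by move=> /andP[/ltW -> /ltW ->].
have inj (x y : R) i j : -1 <= x <= 1 -> -1 <= y <= 1 -> (i < 3)%N -> (j < 3)%N ->
    coord_inv c (vec2 x (f i x)) = coord_inv c (vec2 y (f j y)) -> x = y.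
  move=> x1 y1 iN jN; apply: (square_point_inj square) => //.
    by apply: weak; have [] := graphs_derivable tf iN x1.
  by apply: weak; have [] := graphs_derivable tf jN y1.
have x1 : [/\ -1 <= x01 <= 1, -1 <= x02 <= 1 & -1 <= x12 <= 1].
  by split; apply: weak; [case: C01|case: C02|case: C12].
case: x1 => x011 x021 x121.
rewrite -fsbig_set3; last 3 first.
- by move/(inj _ _ 0%N 0%N x011 x021 isT isT)/eqP; apply/negP.
- by move/(inj _ _ 0%N 1%N x011 x121 isT isT)/eqP; apply/negP.
- by move/(inj _ _ 0%N 1%N x021 x121 isT isT)/eqP; apply/negP.
congr (\sum_(p \in _) _); apply/seteqP; split=> [p|p [[|]|] -> //].
move/(crossings_in_disk ac tf tD) => [x [i [j [[x1 iN jN] fij dij Ei Ej]]]].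
have eq01 : f 0%N x = f 1%N x -> x = x01 := cross_once_eq C01 x1.
have eq02 : f 0%N x = f 2%N x -> x = x02 := cross_once_eq C02 x1.
have eq12 : f 1%N x = f 2%N x -> x = x12 := cross_once_eq C12 x1.
have in01 : p = coord_inv c (vec2 x (f 0%N x)) -> x = x01 -> [set p01; p02; p12] p.
  by move=> -> ->; left; left.
have in02 : p = coord_inv c (vec2 x (f 0%N x)) -> x = x02 -> [set p01; p02; p12] p.
  by move=> -> ->; left; right.
have in12 : p = coord_inv c (vec2 x (f 1%N x)) -> x = x12 -> [set p01; p02; p12] p.
  by move=> -> ->; right.
move: i j iN jN fij dij Ei Ej => [|[|[|//]]] [|[|[|//]]] _ _ fij dij Ei Ej.
- by rewrite ltxx in dij.
- exact: in01 Ei (eq01 fij).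
- exact: in02 Ei (eq02 fij).
- exact: in01 Ej (eq01 (esym fij)).
- by rewrite ltxx in dij.
- exact: in12 Ei (eq12 fij).
- exact: in02 Ej (eq02 (esym fij)).
- exact: in12 Ej (eq12 (esym fij)).
- by rewrite ltxx in dij.
Qed.

(** Between [x01] and [x12] strand 1 is the lowest, and the triangle [Y] lies just above it, below
    the other two. Each outer strip that does not cross the whole square extends up to the crossing
    that closes it. *)
Lemma triangle_left : x01 < x02 -> x02 < x12 ->
  exists h0 h1 h2 h3 h4 h5 Y,
  [/\ hexagon f col x02 x01 x12 x02 h0 h1 h2 h3 h4 h5,
      crossing_rule T (rev 1%N) (rev 0%N) h1 h2 h3 Y,
      crossing_rule T (rev 2%N) (rev 0%N) h0 h1 Y h5,
      crossing_rule T (rev 2%N) (rev 1%N) h5 Y h3 h4 &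
      \sum_(p \in crossings D `&` U) local p =
        crossing_chain (rev 1%N) (rev 0%N) h1 h2 h3 Y +
        crossing_chain (rev 2%N) (rev 0%N) h0 h1 Y h5 +
        crossing_chain (rev 2%N) (rev 1%N) h5 Y h3 h4].
Proof.
move=> lt1 lt2; have lt3 := lt_trans lt1 lt2.
have [h0 u0] : exists h, uniform (among [:: 0; 1; 2]%N) (-2) 2 h.
  apply: (uniform_exists square colD tf tD) => x i j _ _.
  by move: i j => [|[|[|//]]] [|[|[|//]]].
have [h3 u3] : exists h, uniform (among [::]) (-2) 2 h.
  by apply: (uniform_exists square colD tf tD).
have [h1 u1] : exists h, uniform (among [:: 0; 1]%N) (-2) x02 h.
  apply: (uniform_exists square colD tf tD) => x i j /andP[_ xb] /andP[xm _].
  move: i j => [|[|[|//]]] [|[|[|//]]] //= _ _ _ _.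
    exact: cross_once_lt C02 xm xb.
  exact: cross_once_lt C12 xm (lt_trans xb lt2).
have [h2 u2] : exists h, uniform (among [:: 0]%N) (-2) x01 h.
  apply: (uniform_exists square colD tf tD) => x i j /andP[_ xb] /andP[xm _].
  move: i j => [|[|[|//]]] [|[|[|//]]] //= _ _ _ _.
    exact: cross_once_lt C01 xm xb.
  exact: cross_once_lt C02 xm (lt_trans xb lt1).
have [Y uY] : exists h, uniform (among [:: 1]%N) x01 x12 h.
  apply: (uniform_exists square colD tf tD) => x i j /andP[ax xb] /andP[xm xp].
  move: i j => [|[|[|//]]] [|[|[|//]]] //= _ _ _ _.
    exact: cross_once_gt C01 xp ax.
  exact: cross_once_lt C12 xm xb.
have [h4 u4] : exists h, uniform (among [:: 2]%N) x12 2 h.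
  apply: (uniform_exists square colD tf tD) => x i j /andP[ax _] /andP[_ xp].
  move: i j => [|[|[|//]]] [|[|[|//]]] //= _ _ _ _.
    exact: cross_once_gt C02 xp (lt_trans lt2 ax).
  exact: cross_once_gt C12 xp ax.
have [h5 u5] : exists h, uniform (among [:: 1; 2]%N) x02 2 h.
  apply: (uniform_exists square colD tf tD) => x i j /andP[ax _] /andP[_ xp].
  move: i j => [|[|[|//]]] [|[|[|//]]] //= _ _ _ _.
    exact: cross_once_gt C01 xp (lt_trans lt1 ax).
  exact: cross_once_gt C02 xp ax.
have [/andP[m01 p01'] _ e01 _ _] := C01; have [/andP[m02 p02'] _ e02 _ _] := C02.
have [/andP[m12 p12'] _ e12 _ _] := C12.
have n2 x : -1 < x -> -2 < x :> R by lra.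
have p2 x : x < 1 -> x < 2 :> R by lra.
have [D1 U1 E1 r1] : [/\ crossings D p01, U p01,
    local p01 = crossing_chain (rev 1%N) (rev 0%N) h1 h2 h3 Y &
    crossing_rule T (rev 1%N) (rev 0%N) h1 h2 h3 Y].
  have H := graph_crossing ac square colD tf tD (sig := fun=> false) (i := 0%N) (j := 1%N)
    (x0 := x01) _ isT isT e01 (cross_slope C01 isT isT) _ u1 _ _ u2 _ _ u3 _ _ uY _ _ erefl.
  apply: H; try exact: forall_lt3.
  - by rewrite m01 p01'.
  - by move=> [|[|[|//]]] //= _ _ _; exact: cross_once_lt C02 (ltW m01) lt1.
  - by rewrite n2.
  - by rewrite n2 /=.
  - by rewrite n2 ?p2.
  - by rewrite lexx.
have [D2 U2 E2 r2] : [/\ crossings D p02, U p02,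
    local p02 = crossing_chain (rev 2%N) (rev 0%N) h0 h1 Y h5 &
    crossing_rule T (rev 2%N) (rev 0%N) h0 h1 Y h5].
  have H := graph_crossing ac square colD tf tD (sig := among [:: 1]%N) (i := 0%N) (j := 2%N)
    (x0 := x02) _ isT isT e02 (cross_slope C02 isT isT) _ u0 _ _ u1 _ _ uY _ _ u5 _ _ erefl.
  apply: H; try exact: forall_lt3.
  - by rewrite m02 p02'.
  - by move=> [|[|[|//]]] //= _ _ _; exact: cross_once_gt C01 (ltW p02') lt1.
  - by rewrite n2 ?p2.
  - by rewrite n2 /=.
  - by rewrite lt1.
  - by rewrite lexx p2.
have [D3 U3 E3 r3] : [/\ crossings D p12, U p12,
    local p12 = crossing_chain (rev 2%N) (rev 1%N) h5 Y h3 h4 &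
    crossing_rule T (rev 2%N) (rev 1%N) h5 Y h3 h4].
  have H := graph_crossing ac square colD tf tD (sig := among [::]) (i := 1%N) (j := 2%N)
    (x0 := x12) _ isT isT e12 (cross_slope C12 isT isT) _ u5 _ _ uY _ _ u3 _ _ u4 _ _ erefl.
  apply: H; try exact: forall_lt3.
  - by rewrite m12 p12'.
  - by move=> [|[|[|//]]] //= _ _ _; exact: cross_once_gt C01 (ltW p12') lt3.
  - by rewrite lt2 p2.
  - by rewrite lt3 /=.
  - by rewrite n2 ?p2.
  - by rewrite lexx p2.
exists h0, h1, h2, h3, h4, h5, Y; split=> //.
by rewrite triangle_sum ?E1 ?E2 ?E3 // lt_eqF.
Qed.

(** Here strand 1 is the highest between [x12] and [x01], and the triangle lies just below it, above
    the other two strands. *)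
Lemma triangle_right : x12 < x02 -> x02 < x01 ->
  exists h0 h1 h2 h3 h4 h5 Y,
  [/\ hexagon f col x12 x02 x02 x01 h0 h1 h2 h3 h4 h5,
      crossing_rule T (rev 2%N) (rev 1%N) h0 h1 h2 Y,
      crossing_rule T (rev 2%N) (rev 0%N) Y h2 h3 h4,
      crossing_rule T (rev 1%N) (rev 0%N) h0 Y h4 h5 &
      \sum_(p \in crossings D `&` U) local p =
        crossing_chain (rev 2%N) (rev 1%N) h0 h1 h2 Y +
        crossing_chain (rev 2%N) (rev 0%N) Y h2 h3 h4 +
        crossing_chain (rev 1%N) (rev 0%N) h0 Y h4 h5].
Proof.
move=> lt1 lt2; have lt3 := lt_trans lt1 lt2.
have [h0 u0] : exists h, uniform (among [:: 0; 1; 2]%N) (-2) 2 h.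
  apply: (uniform_exists square colD tf tD) => x i j _ _.
  by move: i j => [|[|[|//]]] [|[|[|//]]].
have [h3 u3] : exists h, uniform (among [::]) (-2) 2 h.
  by apply: (uniform_exists square colD tf tD).
have [h1 u1] : exists h, uniform (among [:: 0; 1]%N) (-2) x12 h.
  apply: (uniform_exists square colD tf tD) => x i j /andP[_ xb] /andP[xm _].
  move: i j => [|[|[|//]]] [|[|[|//]]] //= _ _ _ _.
    exact: cross_once_lt C02 xm (lt_trans xb lt1).
  exact: cross_once_lt C12 xm xb.
have [h2 u2] : exists h, uniform (among [:: 0]%N) (-2) x02 h.
  apply: (uniform_exists square colD tf tD) => x i j /andP[_ xb] /andP[xm _].
  move: i j => [|[|[|//]]] [|[|[|//]]] //= _ _ _ _.
    exact: cross_once_lt C01 xm (lt_trans xb lt2).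
  exact: cross_once_lt C02 xm xb.
have [Y uY] : exists h, uniform (among [:: 0; 2]%N) x12 x01 h.
  apply: (uniform_exists square colD tf tD) => x i j /andP[ax xb] /andP[xm xp].
  move: i j => [|[|[|//]]] [|[|[|//]]] //= _ _ _ _.
    exact: cross_once_lt C01 xm xb.
  exact: cross_once_gt C12 xp ax.
have [h4 u4] : exists h, uniform (among [:: 2]%N) x02 2 h.
  apply: (uniform_exists square colD tf tD) => x i j /andP[ax _] /andP[_ xp].
  move: i j => [|[|[|//]]] [|[|[|//]]] //= _ _ _ _.
    exact: cross_once_gt C02 xp ax.
  exact: cross_once_gt C12 xp (lt_trans lt1 ax).
have [h5 u5] : exists h, uniform (among [:: 1; 2]%N) x01 2 h.
  apply: (uniform_exists square colD tf tD) => x i j /andP[ax _] /andP[_ xp].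
  move: i j => [|[|[|//]]] [|[|[|//]]] //= _ _ _ _.
    exact: cross_once_gt C01 xp ax.
  exact: cross_once_gt C02 xp (lt_trans lt2 ax).
have [/andP[m01 p01'] _ e01 _ _] := C01; have [/andP[m02 p02'] _ e02 _ _] := C02.
have [/andP[m12 p12'] _ e12 _ _] := C12.
have n2 x : -1 < x -> -2 < x :> R by lra.
have p2 x : x < 1 -> x < 2 :> R by lra.
have [D3 U3 E3 r3] : [/\ crossings D p12, U p12,
    local p12 = crossing_chain (rev 2%N) (rev 1%N) h0 h1 h2 Y &
    crossing_rule T (rev 2%N) (rev 1%N) h0 h1 h2 Y].
  have H := graph_crossing ac square colD tf tD (sig := among [:: 0]%N) (i := 1%N) (j := 2%N)
    (x0 := x12) _ isT isT e12 (cross_slope C12 isT isT) _ u0 _ _ u1 _ _ u2 _ _ uY _ _ erefl.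
  apply: H; try exact: forall_lt3.
  - by rewrite m12 p12'.
  - by move=> [|[|[|//]]] //= _ _ _; exact: cross_once_lt C01 (ltW m12) lt3.
  - by rewrite n2 ?p2.
  - by rewrite n2 /=.
  - by rewrite n2.
  - by rewrite lexx.
have [D2 U2 E2 r2] : [/\ crossings D p02, U p02,
    local p02 = crossing_chain (rev 2%N) (rev 0%N) Y h2 h3 h4 &
    crossing_rule T (rev 2%N) (rev 0%N) Y h2 h3 h4].
  have H := graph_crossing ac square colD tf tD (sig := among [::]) (i := 0%N) (j := 2%N)
    (x0 := x02) _ isT isT e02 (cross_slope C02 isT isT) _ uY _ _ u2 _ _ u3 _ _ u4 _ _ erefl.
  apply: H; try exact: forall_lt3.
  - by rewrite m02 p02'.
  - by move=> [|[|[|//]]] //= _ _ _; exact: cross_once_lt C01 (ltW m02) lt2.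
  - by rewrite lt1.
  - by rewrite n2 /=.
  - by rewrite n2 ?p2.
  - by rewrite lexx p2.
have [D1 U1 E1 r1] : [/\ crossings D p01, U p01,
    local p01 = crossing_chain (rev 1%N) (rev 0%N) h0 Y h4 h5 &
    crossing_rule T (rev 1%N) (rev 0%N) h0 Y h4 h5].
  have H := graph_crossing ac square colD tf tD (sig := among [:: 2]%N) (i := 0%N) (j := 1%N)
    (x0 := x01) _ isT isT e01 (cross_slope C01 isT isT) _ u0 _ _ uY _ _ u4 _ _ u5 _ _ erefl.
  apply: H; try exact: forall_lt3.
  - by rewrite m01 p01'.
  - by move=> [|[|[|//]]] //= _ _ _; exact: cross_once_gt C02 (ltW p01') lt2.
  - by rewrite n2 ?p2.
  - by rewrite lt3 /=.
  - by rewrite lt2 p2.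
  - by rewrite lexx p2.
exists h0, h1, h2, h3, h4, h5, Y; split=> //.
rewrite triangle_sum ?E1 ?E2 ?E3 // ?gt_eqF //.
(* [triangle_sum] lists the crossings as 01, 02, 12, whereas the statement follows their order from
   left to right. *)
by rewrite addrC [X in _ + X = _]addrC addrA.
Qed.

End OneDiagram.

Variables (D D' : diagram F) (col col' : F -> X).
Hypotheses (colD : coloring D T col) (colD' : coloring D' T col').
Hypothesis agree : agree_off D D' col col' U.
Variables f g : nat -> R -> R.
Hypotheses (tf : tangle 3 (graphs f)) (tg : tangle 3 (graphs g)).
Hypothesis tD : forall p, U p ->
  tangents D c p = tangle_tangents 3 (graphs f) rev (c p).
Hypothesis tD' : forall p, U p ->
  tangents D' c p = tangle_tangents 3 (graphs g) rev (c p).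
Hypothesis ends : forall k, (k < 3)%N -> f k (-1) = g k (-1) /\ f k 1 = g k 1.

(** The strands are ordered 0, 1, 2 from bottom to top on the left side and in reverse on the right
    side. Each of the six outer strips touches one of these sides; the bounds on [l1], ..., [r2']
    ensure that its range reaches it. *)
Lemma hexagon_match x01 x02 x12 l1 l2 r1 r2 l1' l2' r1' r2'
    h0 h1 h2 h3 h4 h5 k0 k1 k2 k3 k4 k5 :
  cross_once_at (f 0%N) (f 1%N) x01 -> cross_once_at (f 0%N) (f 2%N) x02 ->
  cross_once_at (f 1%N) (f 2%N) x12 ->
  -1 < l1 -> -1 < l2 -> r1 < 1 -> r2 < 1 -> -1 < l1' -> -1 < l2' -> r1' < 1 -> r2' < 1 ->
  hexagon f col l1 l2 r1 r2 h0 h1 h2 h3 h4 h5 ->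
  hexagon g col' l1' l2' r1' r2' k0 k1 k2 k3 k4 k5 ->
  [/\ h0 = k0, h1 = k1, h2 = k2 & [/\ h3 = k3, h4 = k4 & h5 = k5]].
Proof.
move=> C01 C02 C12 L1 L2 R1 R2 L1' L2' R1' R2'.
move=> [u0 u1 u2 u3 [u4 u5]] [v0 v1 v2 v3 [v4 v5]].
have [n21 p12] : (-2 : R) < -1 /\ (1 : R) < 2 by split; lra.
have m2 : (-1 : R) < 2 by lra.
have left sig h k l l' : uniform c 3 f col sig (-2) l h ->
    uniform c 3 g col' sig (-2) l' k -> -1 < l -> -1 < l' ->
    (forall i j, (i < 3)%N -> (j < 3)%N -> sig i -> ~~ sig j -> (i < j)%N) -> h = k.
  move=> u v L L' sep.
  apply: (uniform_match square colD colD' agree tf tD tD' (x := -1) _ _ _ _ _ u v).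
  - by left.
  - by move=> i /ends[].
  - by rewrite n21.
  - by rewrite n21.
  - move=> i j iN jN si sj; have := sep i j iN jN si sj.
    have [/andP[m01 _] _ _ _ _] := C01; have [/andP[m02 _] _ _ _ _] := C02.
    have [/andP[m12 _] _ _ _ _] := C12.
    move: i j iN jN {si sj sep} => [|[|[|//]]] [|[|[|//]]] // _ _ _.
    + exact: cross_once_lt C01 (lexx _) m01.
    + exact: cross_once_lt C02 (lexx _) m02.
    + exact: cross_once_lt C12 (lexx _) m12.
have right sig h k r r' : uniform c 3 f col sig r 2 h ->
    uniform c 3 g col' sig r' 2 k -> r < 1 -> r' < 1 ->
    (forall i j, (i < 3)%N -> (j < 3)%N -> sig i -> ~~ sig j -> (j < i)%N) -> h = k.
  move=> u v L L' sep.
  apply: (uniform_match square colD colD' agree tf tD tD' (x := 1) _ _ _ _ _ u v).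
  - by right.
  - by move=> i /ends[].
  - by rewrite L.
  - by rewrite L'.
  - move=> i j iN jN si sj; have := sep i j iN jN si sj.
    have [/andP[_ m01] _ _ _ _] := C01; have [/andP[_ m02] _ _ _ _] := C02.
    have [/andP[_ m12] _ _ _ _] := C12.
    move: i j iN jN {si sj sep} => [|[|[|//]]] [|[|[|//]]] // _ _ _.
    + exact: cross_once_gt C01 (lexx _) m01.
    + exact: cross_once_gt C02 (lexx _) m02.
    + exact: cross_once_gt C12 (lexx _) m12.
split; last split.
- by apply: left u0 v0 _ _ _ => // -[|[|[|//]]] [|[|[|//]]].
- by apply: left u1 v1 _ _ _ => // -[|[|[|//]]] [|[|[|//]]].
- by apply: left u2 v2 _ _ _ => // -[|[|[|//]]] [|[|[|//]]].
- by apply: left u3 v3 _ _ _.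
- by apply: right u4 v4 _ _ _ => // -[|[|[|//]]] [|[|[|//]]].
- by apply: right u5 v5 _ _ _ => // -[|[|[|//]]] [|[|[|//]]].
Qed.

Variables L Q : X -> X -> X -> X.
Hypothesis hX : iktq T L Q.

Lemma move3_chain (x01 x02 x12 y01 y02 y12 : R) :
  cross_once_at (f 0%N) (f 1%N) x01 -> cross_once_at (f 0%N) (f 2%N) x02 ->
  cross_once_at (f 1%N) (f 2%N) x12 -> x01 < x02 -> x02 < x12 ->
  cross_once_at (g 0%N) (g 1%N) y01 -> cross_once_at (g 0%N) (g 2%N) y02 ->
  cross_once_at (g 1%N) (g 2%N) y12 -> y12 < y02 -> y02 < y01 ->
  boundaries T (chainI T) (\sum_(p \in crossings D `&` U) local_chain D col p -
    \sum_(p \in crossings D' `&` U) local_chain D' col' p).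
Proof.
move=> C01 C02 C12 lt1 lt2 E01 E02 E12 lt1' lt2'.
have [h0 [h1 [h2 [h3 [h4 [h5 [Y [hexf a1 a2 a3 ->]]]]]]]] :=
  triangle_left colD tf tD C01 C02 C12 lt1 lt2.
have [k0 [k1 [k2 [k3 [k4 [k5 [Y' [hexg b1 b2 b3 ->]]]]]]]] :=
  triangle_right colD' tg tD' E01 E02 E12 lt1' lt2'.
have [/andP[? ?] _ _ _ _] := C01; have [/andP[? ?] _ _ _ _] := C02.
have [/andP[? ?] _ _ _ _] := C12; have [/andP[? ?] _ _ _ _] := E01.
have [/andP[? ?] _ _ _ _] := E02; have [/andP[? ?] _ _ _ _] := E12.
have [||||||||e0 e1 e2 [e3 e4 e5]] := hexagon_match C01 C02 C12 _ _ _ _ _ _ _ _ hexf hexg => //.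
rewrite -e0 -e1 -e2 -e3 -e4 -e5 in b1 b2 b3 *.
exact: (triangle_chain hX a1 a2 a3 b1 b2 b3).
Qed.

End Triangle.

(** * The first move *)

Section Curl.
Variables (R : realType) (F : oriented_surface R).
Local Notation plane := 'rV[R]_2.
Local Notation domain_interior c := (interior (c @` chart_dom c)).
Variables (X : choiceType) (T : X -> X -> X -> X).
Variable c : chart R F.
Hypothesis ac : atlas F c.
Hypothesis square : [set v : plane | `|v| <= 1] `<=` domain_interior c.
Local Notation U := [set p | chart_dom c p /\ `|c p| <= 1].
Variable rev : nat -> bool.
Variables (D : diagram F) (col : F -> X).
Hypothesis colD : coloring D T col.
Variables (s : nat -> R -> plane) (w : R -> R).
Hypothesis s_w : forall t, s 0%N t = vec2 (t ^+ 2) (w t).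
Hypothesis tangle_s : tangle 1 s.
Hypothesis tangents_s : forall p, U p ->
  tangents D c p = tangle_tangents 1 s rev (c p).

Lemma curl_derive1 t : -1 <= t <= 1 -> -1 < w t < 1 /\
  derive1 (s 0%N) t = vec2 (2 * t) (derive1 w t).
Proof.
move=> t1; have [dk _ wt1] := tangle_s (isT : (0 < 1)%N) t1.
split; first by move: wt1; rewrite s_w vec2_1 ltr_norml.
rewrite [LHS]vec2_eta derive1E derive_mx // !mxE; congr vec2.
  have -> : (fun t0 : R => s 0%N t0 0 0) = (@GRing.exp R)^~ 2%N.
    by apply/funext => y; rewrite s_w vec2_0.
  by rewrite exp_derive expr1 [_ *: 1]mulr1.
by rewrite derive1E; congr ('D_1 _ t); apply/funext => y; rewrite s_w vec2_1.
Qed.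

(** Equal abscissae force the two passages to be at opposite parameters. Both belong to the same
    strand with the same orientation, so the horizontal parts of their tangents cancel and [u + v],
    the direction of the top corner, is vertical. It is nonzero because the determinant of the
    tangents is a multiple of its height. *)
Lemma curl_double p : (crossings D `&` U) p -> exists t,
  [/\ 0 < t <= 1, w t = w (- t), c p = vec2 (t ^+ 2) (w t) &
    exists2 d, d != 0 &
    exists u v, [/\ tangents D c p u, tangents D c p v, 0 < det2 u v &
      u + v = vec2 0 d]].
Proof.
move=> [Dp Up]; have [cp p1] := Up.
move: Dp => /(crossingsP _ ac cp); rewrite (tangents_s Up).
case=> u [v [[k [x [r [kn x1 Ex r0 ->]]]] [l [y [r' [ln y1 Ey r0' ->]]]]]].
move: k l kn ln Ex Ey => [|//] [|//] _ _ Ex Ey.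
have sgn2 : (-1) ^+ rev 0%N * (-1) ^+ rev 0%N = 1 :> R by rewrite -expr2 sqrr_sign.
have signs (e m k d : R) : e * e = 1 -> m * (e * (k * (e * d))) = m * k * d.
  by move=> e2; rewrite -[RHS]mul1r -e2; ring.
rewrite !det2Zl !det2Zr (signs _ _ _ _ sgn2).
rewrite pmulr_rgt0 ?mulr_gt0 // => uv.
have [[wx1 dx] [wy1 dy]] := (curl_derive1 x1, curl_derive1 y1).
have E : vec2 (x ^+ 2) (w x) = vec2 (y ^+ 2) (w y) by rewrite -!s_w Ex Ey.
have wE : w x = w y by have := congr1 (fun v : plane => v 0 1) E; rewrite !vec2_1.
have /eqP : x ^+ 2 = y ^+ 2 by have := congr1 (fun v : plane => v 0 0) E; rewrite !vec2_0.
rewrite eqf_sqr => /orP[/eqP xy|/eqP xy].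
  by move: uv; rewrite xy det2vv ltxx.
have yE : y = - x by rewrite xy opprK.
rewrite dx dy yE /det2 !vec2_0 !vec2_1 in uv.
pose d : R := (-1) ^+ rev 0%N * (derive1 w x + derive1 w (- x)).
have x0 : x != 0.
  by apply/eqP => x0; move: uv; rewrite x0 !(oppr0, mulr0, mul0r, addr0) ltxx.
have d0 : d != 0.
  rewrite mulf_neq0 ?signr_eq0 //; apply/eqP => d0; move: uv.
  have E2 (y1' y2' : R) : 2 * x * y2' - y1' * (2 * - x) = 2 * x * (y1' + y2') by ring.
  by rewrite E2 d0 mulr0 ltxx.
have mem z : -1 <= z <= 1 -> s 0%N z = c p ->
    tangle_tangents 1 s rev (c p) ((-1) ^+ rev 0%N *: derive1 (s 0%N) z).
  by move=> z1 Ez; exists 0%N, z, 1; split=> //; rewrite scale1r.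
have tx := mem x x1 Ex; have ty := mem y y1 Ey.
have uvE : (-1) ^+ rev 0%N *: derive1 (s 0%N) x + (-1) ^+ rev 0%N *: derive1 (s 0%N) y
    = vec2 0 d.
  rewrite dx dy yE -scalerDr; apply/rowP => j; rewrite !mxE /d.
  by case: ifP => _; ring.
exists `|x|; rewrite normr_gt0 x0 ler_norml x1 /=.
have absx : w `|x| = w x /\ w (- `|x|) = w x.
  by case: (ger0P x) => _; rewrite ?opprK -yE -wE.
have absx2 : `|x| ^+ 2 = x ^+ 2 by case: (ger0P x) => _; rewrite ?sqrrN.
rewrite !absx.1 absx.2 absx2; split=> //; first by rewrite -Ex s_w.
exists d => //.
exists ((-1) ^+ rev 0%N *: derive1 (s 0%N) x), ((-1) ^+ rev 0%N *: derive1 (s 0%N) y).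
split=> //.
rewrite det2Zl det2Zr mulrA -expr2 sqrr_sign mul1r dx dy yE /det2 !vec2_0 !vec2_1.
exact: uv.
Qed.

Lemma curl_segment (x y x' y' : R) :
  (forall t, 0 <= t <= 1 -> -1 <= x + t * (x' - x) <= 1 /\ -1 <= y + t * (y' - y) <= 1) ->
  (forall t r, 0 <= t <= 1 -> -1 <= r <= 1 -> r ^+ 2 = x + t * (x' - x) ->
     w r <> y + t * (y' - y)) ->
  col_at c col x y = col_at c col x' y'.
Proof.
move=> H1 H2; apply: (coloring_segment colD) => t t01.
have E : vec2 x y + t *: (vec2 x' y' - vec2 x y) =
    vec2 (x + t * (x' - x)) (y + t * (y' - y)).
  by apply/rowP => j; rewrite !mxE; case: ifP.
have q1 : `|vec2 (x + t * (x' - x)) (y + t * (y' - y))| <= 1.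
  by rewrite norm_vec2_le1; have [-> ->] := H1 t t01.
rewrite E; split; first exact: square.
move/(underlying_tangle square tangents_s q1) => [k [r [kn r1 Er]]].
move: k kn Er => [|//] _; rewrite s_w => Er.
have := congr1 (fun v : plane => v 0 0) Er; rewrite !vec2_0 => /(H2 t r t01 r1).
by have := congr1 (fun v : plane => v 0 1) Er; rewrite !vec2_1.
Qed.

(* Off the double point, the vertical line through it meets only the region
   which surrounds the loop. *)
Lemma curl_outside a y : 0 < a <= 1 -> w (- a) = w a -> -1 <= y <= 1 -> y != w a ->
  col_at c col (a ^+ 2) y = col_at c col (-1) (-1).
Proof.
move=> /andP[a0 a1] wa y1 yw.
have a2 : 0 <= a ^+ 2 <= 1 by rewrite sqr_ge0 expr_le1 // ltW.
have wa1 : -1 < w a < 1.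
  by have [] := @curl_derive1 a; first by rewrite a1 andbT; lra.
have bound r : -1 <= r <= 1 -> -1 < w r < 1 by move=> /curl_derive1[].
(* Only the parameters [a] and [- a] lie over the abscissa of the double point, so the vertical line
   there meets the strand at a single height. *)
have at_a r : r ^+ 2 = a ^+ 2 -> w r = w a.
  by move/eqP; rewrite eqf_sqr => /orP[] /eqP ->.
(* The detour follows the upper side of the square and then its left side, which the strand avoids
   because its abscissae are squares. *)
have across : col_at c col (a ^+ 2) 1 = col_at c col (-1) (-1).
  rewrite (@curl_segment _ _ (-1) 1); first last.
  - by move=> t r _ /bound; rewrite subrr mulr0 addr0 => /andP[_ +] _ E; rewrite E ltxx.
  - move=> t t01; rewrite subrr mulr0 addr0; split; apply/andP; split; nra.
  apply: curl_segment => [t t01|t r t01 _ E].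
    split; apply/andP; split; nra.
  by have := sqr_ge0 r; rewrite E; nra.
have bottom : col_at c col (a ^+ 2) (-1) = col_at c col (-1) (-1).
  apply: curl_segment => [t t01|t r _ /bound].
    split; apply/andP; split; nra.
  by rewrite subrr mulr0 addr0 => /andP[+ _] _ E; rewrite E ltxx.
move: yw; rewrite neq_lt => /orP[yw|yw].
  rewrite -bottom; apply: curl_segment => [t t01|t r t01 _].
    split; apply/andP; split; nra.
  by rewrite subrr mulr0 addr0 => /at_a ->; nra.
rewrite -across; apply: curl_segment => [t t01|t r t01 _].
  split; apply/andP; split; nra.
by rewrite subrr mulr0 addr0 => /at_a ->; nra.
Qed.

Variables L Q : X -> X -> X -> X.
Hypothesis hX : iktq T L Q.

(** The top and bottom corners lie vertically above and below the double point, both outside the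
    loop. With their common color b the crossing rule reads b = T(a, b, c), that is, c = R(a, b, b),
    whichever side the loop is on. *)
Lemma curl_degenerate p : (crossings D `&` U) p ->
  chainID T L Q (n := 1) (local_chain D col p).
Proof.
move=> Dp; have [a [a01 wa cpE [d d0 [u [v [tu tv uv uvE]]]]]] := curl_double Dp.
have [cp p1] := Dp.2.
have a1 : -1 <= a <= 1 by move/andP: a01 => [? ?]; apply/andP; split; lra.
have [/andP[wam wap] _] := curl_derive1 a1.
have p10 : 1 != 0 :> R by rewrite oner_eq0.
have n10 : -1 != 0 :> R by rewrite oppr_eq0 oner_eq0.
have outside (z : R) x : z != 0 -> x = z *: vec2 0 d ->
    \forall r \near (0 : R)^'+, col (coord_inv c (c p + r *: x)) = col_at c col (-1) (-1).
  move=> z0 ->; apply/near_right.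
  have zd0 : 0 < `|z * d| by rewrite normr_gt0 mulf_neq0.
  (* The distance from the double point to the horizontal sides: shorter vertical displacements stay
     in the square. *)
  pose m := Num.min (1 - w a) (w a + 1).
  have m0 : 0 < m by rewrite lt_min; apply/andP; split; lra.
  exists (m / `|z * d|) => [|r /andP[r0 rm]]; first exact: divr_gt0.
  have rzd : `|r * (z * d)| < m.
    by rewrite normrM gtr0_norm // -ltr_pdivlMr.
  have -> : c p + r *: (z *: vec2 0 d) = vec2 (a ^+ 2) (w a + r * (z * d)).
    by rewrite cpE; apply/rowP => j; rewrite !mxE; case: ifP => _; ring.
  apply: curl_outside => //.
    move: rzd; rewrite lt_min => /andP[]; rewrite !ltr_norml => /andP[? ?] /andP[? ?].
    by apply/andP; split; lra.
  by rewrite -subr_eq0 addrAC subrr add0r !mulf_eq0 !negb_or gt_eqF // z0 d0.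
have topE : corner_top D col p = col_at c col (-1) (-1).
  apply: (corner_eq colD ac cp tu tv uv p10 p10); apply: (outside 1) => //.
  by rewrite !scale1r.
have bottomE : corner_bottom D col p = col_at c col (-1) (-1).
  apply: (corner_eq colD ac cp tu tv uv n10 n10); apply: (outside (-1)) => //.
  by rewrite -scalerDr uvE.
rewrite /local_chain -(iktq_right hX (corner_left D col p) (corner_bottom D col p)
  (corner_right D col p)) -(colD.2 p Dp.1) topE bottomE.
exact: triple_degenerate.
Qed.

End Curl.

(** * From local pictures to homology classes *)

Section Moves.
Variables (R : realType) (F : oriented_surface R).
Local Notation plane := 'rV[R]_2.
Variables (X : choiceType) (T L Q : X -> X -> X -> X).
Hypothesis hX : iktq T L Q.

Lemma boundaries_sub (N N' : forall n, set (chain X n)) n :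
  N n.+1 `<=` N' n.+1 -> boundaries T N (n := n) `<=` boundaries T N' (n := n).
Proof. by move=> NN' z [w hw]; exists w; exact: NN'. Qed.

Lemma boundaries_trivial (N : forall n, set (chain X n)) n :
  N n.+1 `<=` boundaries T N (n := n).
Proof.
by move=> z Nz; exists 0; rewrite -(subrr 0) bdB subrr subr0.
Qed.

Lemma move_boundaries n (c : chart R F) (D D' : diagram F) (col col' : F -> X)
    (s s' : nat -> R -> plane) (rev : nat -> bool) :
  let U := [set p | chart_dom c p /\ `|c p| <= 1] in
  let diff := \sum_(p \in crossings D `&` U) local_chain D col p -
    \sum_(p \in crossings D' `&` U) local_chain D' col' p in
  atlas F c -> [set v : plane | `|v| <= 1] `<=` interior (c @` chart_dom c) ->
  coloring D T col -> coloring D' T col' -> agree_off D D' col col' U ->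
  (forall p, U p -> tangents D c p = tangle_tangents n s rev (c p)) ->
  (forall p, U p -> tangents D' c p = tangle_tangents n s' rev (c p)) ->
  local_move n s s' ->
  boundaries T (chainID T L Q) diff /\
  ((n = 2 \/ n = 3)%N -> boundaries T (chainI T) diff).
Proof.
move=> U diff ac square colD colD' agree tD tD' [ts ts' ends move].
have I_ID z : boundaries T (chainI T) (n := 0) z -> boundaries T (chainID T L Q) z.
  by apply: boundaries_sub; exact: chainI_sub_ID.
case: n ts ts' tD tD' ends move => [//|[|[|[|//]]]] ts ts' tD tD' ends.
- move=> [w [w' [sw sw' lt [a [a01 lt1 wa _ lt2]]]]].
  split; last by case.
  apply: boundaries_trivial.
  have none : crossings D `&` U = set0.
    apply/seteqP; split=> // p /(curl_double ac sw ts tD)[t [/lt + E _ _]].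
    by rewrite E ltxx.
  (* Locating the crossings in one point is enough: no crossing contributes zero, and a crossing
     there contributes a degenerate triple. *)
  have one : crossings D' `&` U `<=` [set coord_inv c (vec2 (a ^+ 2) (w' a))].
    move=> p Dp; have [t [/andP[t0 t1] E cpE _]] := curl_double ac sw' ts' tD' Dp.
    have [cp _] := Dp.2.
    have [ta|at_|ta] := ltgtP t a.
    - by have := lt1 t; rewrite t0 ta E ltxx => /(_ isT).
    - by have := lt2 t; rewrite t1 at_ E ltxx => /(_ isT).
    - by rewrite /= -(coordK cp) cpE ta.
  rewrite /diff none fsbig_set0 sub0r; apply: spannedN.
  have [->|E] := subset_set1 one; first by rewrite fsbig_set0; exact: spanned0.
  rewrite E fsbig_set1; apply: (curl_degenerate ac square colD' sw' ts' tD' hX).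
  by rewrite E.
- move=> [f [g [sf sg lt [a [b [[am ab bp] gout gin ga gb]]]]]]; subst s s'.
  have fg k : (k < 2)%N -> f k (-1) = g k (-1) /\ f k 1 = g k 1.
    move=> /ends[E1 E2]; split.
      by have := congr1 (fun v : plane => v 0 1) E1; rewrite !vec2_1.
    by have := congr1 (fun v : plane => v 0 1) E2; rewrite !vec2_1.
  suff I : boundaries T (chainI T) diff by split=> //; exact: I_ID.
  rewrite /diff (move2_before ac ts tD lt) fsbig_set0 sub0r; apply: boundaries_trivial.
  apply: spannedN.
  exact: (move2_chain ac square colD colD' agree ts ts' tD tD' fg am ab bp lt gout gin ga gb).
- move=> [f [g [sf sg [x01 [x02 [x12 [C01 C02 C12 lt1 lt2]]]]
    [y01 [y02 [y12 [E01 E02 E12 lt1' lt2']]]]]]]; subst s s'.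
  have fg k : (k < 3)%N -> f k (-1) = g k (-1) /\ f k 1 = g k 1.
    move=> /ends[E1 E2]; split.
      by have := congr1 (fun v : plane => v 0 1) E1; rewrite !vec2_1.
    by have := congr1 (fun v : plane => v 0 1) E2; rewrite !vec2_1.
  suff I : boundaries T (chainI T) diff by split=> //; exact: I_ID.
  exact: (move3_chain ac square colD colD' agree ts ts' tD tD' fg hX
    C01 C02 C12 lt1 lt2 E01 E02 E12 lt1' lt2').
Qed.

Lemma flat_move_boundaries n (D D' : diagram F) (U : set F) (col col' : F -> X) :
  coloring D T col -> coloring D' T col' -> agree_off D D' col col' U ->
  flat_move n D D' U ->
  boundaries T (chainID T L Q) (diagram_chain D col - diagram_chain D' col') /\
  ((n = 2 \/ n = 3)%N ->
    boundaries T (chainI T) (diagram_chain D col - diagram_chain D' col')).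
Proof.
move=> colD colD' agree [c [s [s' [rev [[ac square UE] move tD tD' off]]]]].
subst U.
have off' p c' : ~ (chart_dom c p /\ `|c p| <= 1) -> atlas F c' -> chart_dom c' p ->
    tangents D c' p = tangents D' c' p by exact: off.
have Ucl := closed_disk square.
have p10 : 1 != 0 :> R by rewrite oner_eq0.
have n10 : -1 != 0 :> R by rewrite oppr_eq0 oner_eq0.
rewrite (@diagram_chain_local _ _ _ D D' col col' [set p | chart_dom c p /\ `|c p| <= 1]).
- case: move => [move|move].
    exact: (move_boundaries ac square colD colD' agree tD tD' move).
  (* For a move performed backwards the diagrams exchange roles, and the difference of the chains
     changes sign. *)
  have agree' : agree_off D' D col' col [set p | chart_dom c p /\ `|c p| <= 1].
    by move=> p Up Dp' Dp; apply/esym/agree.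
  have [ID I] := move_boundaries ac square colD' colD agree' tD' tD move.
  split=> [|/I {}I]; rewrite -opprB; apply: boundariesN => //; exact: spannedB.
- by move=> p Up; exact: (crossings_off off' Up).
- move=> p Up Dp; rewrite /local_chain /corner_left /corner_bottom /corner_right.
  by congr triple; apply: (corner_off colD colD' agree off' Ucl Up Dp).
Qed.

End Moves.
Theorem lemma3p4 (R : realType) (X : choiceType) (T L Q : X -> X -> X -> X)
    (hX : iktq T L Q)
    (F : oriented_surface R) (hF : compact [set: F])
    (D D' : diagram F) (U : set F) (col col' : F -> X)
    (hcol : coloring D T col) (hcol' : coloring D' T col')
    (hagree : agree_off D D' col col' U) :
  (forall n : nat, (n = 1 \/ n = 2 \/ n = 3)%N -> flat_move n D D' U ->
     homology_class T (chainID T L Q) (diagram_chain D col) =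
     homology_class T (chainID T L Q) (diagram_chain D' col')) /\
  (forall n : nat, (n = 2 \/ n = 3)%N -> flat_move n D D' U ->
     homology_class T (chainI T) (diagram_chain D col) =
     homology_class T (chainI T) (diagram_chain D' col')).
Proof.
split=> n hn hmove; apply: homology_class_eq; try exact: spannedB.
  by have [] := flat_move_boundaries hX hcol hcol' hagree hmove.
by have [_] := flat_move_boundaries hX hcol hcol' hagree hmove; exact.
Qed.
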